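(* If $W$ is a complete Segal space, then $\mathrm{Tw}\,W$ is a complete Segal space.
   Context: A space means a simplicial set, and a simplicial space is a functor $X\colon \Delta^{op}\to \mathrm{sSet}$, where $\Delta$ is the simplex category; $X_n$ denotes the space $X([n])$. Write $X_{kl}$ for the set of $l$-simplices of $X_k$. Simplicial sets $S$ are regarded as constant simplicial spaces. The category of simplicial spaces is enriched in spaces by $\mathrm{Map}(X,Y)_n=\mathrm{Hom}(X\times\Delta[n],Y)$, with $\Delta[n]$ regarded as a constant simplicial space. $F(n)$ is the simplicial space with $F(n)_{kl}=\mathrm{Hom}_\Delta([k],[n])$ for all $l$, and $\partial F(n)_{kl}=\partial\Delta[n]_k$. Thus $\mathrm{Map}(F(n),X)\cong X_n$. $G(n)\subseteq F(n)$ is the sub-simplicial space of all $\varphi\colon[k]\to[n]$ with $\varphi(k)-\varphi(0)\le 1$, so that $G(n)\cong F(1)\coprod_{F(0)}\cdots\coprod_{F(0)}F(1)$ ($n$ factors). For a category $\mathcal C$, its nerve $N\mathcal C$ is the simplicial space with $(N\mathcal C)_{kl}$ the set of functors $[k]\to\mathcal C$, for all $l$. $I$ is the category with two objects and a single isomorphism between them. A simplicial space $W$ is a complete Segal space if: (Reedy) it is Reedy fibrant, i.e. $\mathrm{Map}(F(n),W)\to\mathrm{Map}(\partial F(n),W)$ is a Kan fibration for all $n\ge 0$; (Segal) for all $n\ge2$ the map $W_n\cong\mathrm{Map}(F(n),W)\to\mathrm{Map}(G(n),W)\cong W_1\times_{W_0}\cdots\times_{W_0}W_1$ induced by $G(n)\hookrightarrow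 F(n)$ is a Kan equivalence (weak homotopy equivalence of simplicial sets); (Complete) the map $\mathrm{Map}(NI,W)\to\mathrm{Map}(F(0),W)\cong W_0$ induced by an inclusion $F(0)\hookrightarrow NI$ is a Kan equivalence. Twisted arrow construction: let $Q\colon\Delta\to\Delta$ be the functor $Q([n])=[n]^{op}\star[n]\cong[2n+1]$, $Q(\alpha)=\alpha^{op}\star\alpha$, where $\star$ is the join of posets. The twisted arrow construction $\mathrm{Tw}$ on simplicial spaces is (up to natural isomorphism) the precomposition functor $Q^*$, so $\mathrm{Tw}(W)_n=W_{2n+1}$. *)

(* Defs.v *)
Set Warnings "-notation-overridden".
From mathcomp Require Import all_boot.
From mathcomp Require Import boolp.
From Stdlib Require Import Relation_Operators.

Set Implicit Arguments.
Unset Strict Implicit.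
Unset Printing Implicit Defensive.

#[local] Obligation Tactic := idtac.

(* The object [n] of the simplex category is encoded by the natural number n,
   with underlying poset 'I_n.+1; mono m n is the set of monotone (not
   necessarily injective) maps [m] -> [n]. *)
Record mono (m n : nat) := Mono {
  mfun :> 'I_m.+1 -> 'I_n.+1;
  mono_homo : forall i j : 'I_m.+1, i <= j -> mfun i <= mfun j }.

Lemma mono_ext m n (a b : mono m n) : a =1 b -> a = b.
Proof.
case: a b => [a ha] [b hb] /= /funext e; case: b / e hb => hb.
by rewrite (Prop_irrelevance ha hb).
Qed.

Definition mid n : mono n n := @Mono n n id (fun _ _ h => h).

Definition mcomp l m n (b : mono m n) (a : mono l m) : mono l n :=
  Mono (fun i j h => mono_homo b (mono_homo a h)).

Record sset := SSet {
  cell :> nat -> Type;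
  act : forall m n, mono m n -> cell n -> cell m;
  act_id : forall n (x : cell n), act (mid n) x = x;
  act_comp : forall l m n (b : mono m n) (a : mono l m) (x : cell n),
    act (mcomp b a) x = act a (act b x) }.

Record smap (X Y : sset) := SMap {
  sfun :> forall n, X n -> Y n;
  smap_nat : forall m n (a : mono m n) (x : X n),
    sfun (act a x) = act a (sfun x) }.

Lemma smap_ext X Y (f g : smap X Y) : (forall n x, f n x = g n x) -> f = g.
Proof.
case: f g => [f hf] [g hg] /= e.
have {}e : f = g by apply: functional_extensionality_dep => n; apply/funext/e.
by case: g / e hg => hg; rewrite (Prop_irrelevance hf hg).
Qed.

Definition sid X : smap X X := @SMap X X (fun _ => id) (fun _ _ _ _ => erefl).

Lemma scomp_nat X Y Z (g : smap Y Z) (f : smap X Y) m n (a : mono m n)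
  (x : X n) : g m (f m (act a x)) = act a (g n (f n x)).
Proof. by rewrite !smap_nat. Qed.

Definition scomp X Y Z (g : smap Y Z) (f : smap X Y) : smap X Z :=
  @SMap X Z (fun n x => g n (f n x)) (scomp_nat g f).

Program Definition sprod (X Y : sset) : sset :=
  @SSet (fun n => (X n * Y n)%type)
        (fun m n a x => (act a x.1, act a x.2)) _ _.
Next Obligation. by move=> X Y n [x y]; rewrite /= !act_id. Qed.
Next Obligation. by move=> X Y l m n b a [x y]; rewrite /= !act_comp. Qed.

Program Definition sprod_map (X X' Y Y' : sset) (f : smap X X')
    (g : smap Y Y') : smap (sprod X Y) (sprod X' Y') :=
  @SMap (sprod X Y) (sprod X' Y') (fun n x => (f n x.1, g n x.2)) _.
Next Obligation. by move=> *; rewrite /= !smap_nat. Qed.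

Program Definition simplex (n : nat) : sset :=
  @SSet (fun k => mono k n) (fun _ _ a f => mcomp f a) _ _.
Next Obligation. by move=> *; apply: mono_ext. Qed.
Next Obligation. by move=> *; apply: mono_ext. Qed.

Program Definition simplex_map m n (a : mono m n) :
    smap (simplex m) (simplex n) :=
  @SMap (simplex m) (simplex n) (fun _ f => mcomp a f) _.
Next Obligation. by move=> *; apply: mono_ext. Qed.

Definition act_closed (X : sset) (P : forall n, X n -> Prop) :=
  forall m n (a : mono m n) (x : X n), P n x -> P m (act a x).

Program Definition ssub (X : sset) (P : forall n, X n -> Prop)
    (hP : act_closed P) : sset :=
  @SSet (fun n => {x : X n | P n x})
        (fun m n a x => exist _ (act a (sval x)) (hP _ _ _ _ (svalP x))) _ _.
Next Obligation. by move=> X P hP n [x hx]; apply: eq_exist; rewrite act_id. Qed.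
Next Obligation.
by move=> X P hP l m n b a [x hx]; apply: eq_exist; rewrite act_comp.
Qed.

Definition ssub_incl (X : sset) (P : forall n, X n -> Prop)
    (hP : act_closed P) : smap (ssub hP) X :=
  @SMap (ssub hP) X (fun _ => sval) (fun _ _ _ _ => erefl).

Definition boundary_pred n k (f : simplex n k) : Prop :=
  exists j : 'I_n.+1, forall i, f i <> j.

Lemma boundary_closed n : act_closed (@boundary_pred n).
Proof. by move=> l m a f [j hj]; exists j => i; apply: hj. Qed.

Definition boundary n : sset := ssub (@boundary_closed n).

Definition boundary_incl n : smap (boundary n) (simplex n) := ssub_incl _.

Definition horn_pred n (r : 'I_n.+1) k (f : simplex n k) : Prop :=
  exists2 j : 'I_n.+1, j <> r & forall i, f i <> j.

Lemma horn_closed n r : act_closed (@horn_pred n r).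
Proof. by move=> l m a f [j jr hj]; exists j => // i; apply: hj. Qed.

Definition horn n (r : 'I_n.+1) : sset := ssub (@horn_closed n r).

Definition horn_incl n (r : 'I_n.+1) : smap (horn r) (simplex n) :=
  ssub_incl _.

(* Only horns of positive dimension: with the formula above, the horn in
   dimension 0 would be empty. *)
Definition kan_fibration (X Y : sset) (p : smap X Y) : Prop :=
  forall n (r : 'I_n.+2) (u : smap (horn r) X) (v : smap (simplex n.+1) Y),
    scomp p u = scomp v (horn_incl r) ->
    exists w : smap (simplex n.+1) X,
      scomp w (horn_incl r) = u /\ scomp p w = v.

Definition kan_complex (X : sset) : Prop :=
  forall n (r : 'I_n.+2) (u : smap (horn r) X),
    exists w : smap (simplex n.+1) X, scomp w (horn_incl r) = u.

Definition smap_act (X Y : sset) m n (a : mono m n)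
    (h : smap (sprod X (simplex n)) Y) : smap (sprod X (simplex m)) Y :=
  scomp h (sprod_map (sid X) (simplex_map a)).

Program Definition sFun (X Y : sset) : sset :=
  @SSet (fun n => smap (sprod X (simplex n)) Y) (@smap_act X Y) _ _.
Next Obligation.
move=> X Y n h; apply: smap_ext => k [x f] /=.
by congr (h k (_, _)); apply: mono_ext.
Qed.
Next Obligation.
move=> X Y l m n b a h; apply: smap_ext => k [x f] /=.
by congr (h k (_, _)); apply: mono_ext.
Qed.

Program Definition sFun_pre (X Y Z : sset) (f : smap X Y) :
    smap (sFun Y Z) (sFun X Z) :=
  @SMap (sFun Y Z) (sFun X Z)
    (fun n h => scomp h (sprod_map f (sid (simplex n)))) _.
Next Obligation. by move=> *; apply: smap_ext. Qed.

Definition vertex n (i : 'I_n.+1) : mono 0 n :=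
  @Mono 0 n (fun=> i) (fun _ _ _ => leqnn i).

(* x and y have the same class in pi_0(X); for general X the edge relation
   alone is not an equivalence relation. *)
Definition connected (X : sset) : X 0 -> X 0 -> Prop :=
  clos_refl_sym_trans (X 0) (fun x y => exists e : X 1,
    act (vertex (@ord0 1)) e = x /\ act (vertex (@ord_max 1)) e = y).

Definition pi0_bijective (X Y : sset) (f : smap X Y) : Prop :=
  (forall x x' : X 0, connected (f 0 x) (f 0 x') -> connected x x') /\
  (forall y : Y 0, exists x : X 0, connected (f 0 x) y).

(* Weak homotopy equivalence of simplicial sets, defined without geometric
   realization as in Joyal-Tierney and Kerodon: f induces a bijection
   pi_0 Fun(Y, Z) -> pi_0 Fun(X, Z) for every Kan complex Z.  No fibrancy of X
   or Y is assumed. *)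
Definition kan_equivalence (X Y : sset) (f : smap X Y) : Prop :=
  forall Z : sset, kan_complex Z -> pi0_bijective (@sFun_pre X Y Z f).

Record sspace := SSpace {
  level :> nat -> sset;
  sact : forall m n, mono m n -> smap (level n) (level m);
  sact_id : forall n, sact (mid n) = sid (level n);
  sact_comp : forall l m n (b : mono m n) (a : mono l m),
    sact (mcomp b a) = scomp (sact a) (sact b) }.

Record ssmap (X Y : sspace) := SSMap {
  ssfun :> forall n, smap (X n) (Y n);
  ssmap_nat : forall m n (a : mono m n),
    scomp (ssfun m) (sact X a) = scomp (sact Y a) (ssfun n) }.

Lemma ssmap_ext X Y (f g : ssmap X Y) :
  (forall k l (x : X k l), f k l x = g k l x) -> f = g.
Proof.
case: f g => [f hf] [g hg] /= e.
have {}e : f = g.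
  by apply: functional_extensionality_dep => n; apply: smap_ext => l x; apply: e.
by case: g / e hg => hg; rewrite (Prop_irrelevance hf hg).
Qed.

Lemma ssmap_natE X Y (f : ssmap X Y) m n (a : mono m n) l (x : X n l) :
  f m l (sact X a l x) = sact Y a l (f n l x).
Proof. exact: (congr1 (fun g : smap _ _ => g l x) (ssmap_nat f a)). Qed.

Program Definition ssid X : ssmap X X :=
  @SSMap X X (fun n => sid (X n)) _.
Next Obligation. by move=> X m n a; apply: smap_ext. Qed.

Program Definition sscomp X Y Z (g : ssmap Y Z) (f : ssmap X Y) : ssmap X Z :=
  @SSMap X Z (fun n => scomp (g n) (f n)) _.
Next Obligation.
by move=> X Y Z g f m n a; apply: smap_ext => l x; rewrite /= !ssmap_natE.
Qed.

Program Definition ssprod (X Y : sspace) : sspace :=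
  @SSpace (fun n => sprod (X n) (Y n))
          (fun m n a => sprod_map (sact X a) (sact Y a)) _ _.
Next Obligation.
by move=> X Y n; apply: smap_ext => l [x y]; rewrite /= !sact_id.
Qed.
Next Obligation.
by move=> X Y l m n b a; apply: smap_ext => k [x y]; rewrite /= !sact_comp.
Qed.

Program Definition ssprod_map (X X' Y Y' : sspace) (f : ssmap X X')
    (g : ssmap Y Y') : ssmap (ssprod X Y) (ssprod X' Y') :=
  @SSMap (ssprod X Y) (ssprod X' Y') (fun n => sprod_map (f n) (g n)) _.
Next Obligation.
by move=> X X' Y Y' f g m n a; apply: smap_ext => l [x y]; rewrite /= !ssmap_natE.
Qed.

(* (constant S)_{kl} = S_l. *)
Program Definition constant (S : sset) : sspace :=
  @SSpace (fun=> S) (fun _ _ _ => sid S) _ _.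
Next Obligation. by []. Qed.
Next Obligation. by move=> *; apply: smap_ext. Qed.

Program Definition constant_map (S T : sset) (f : smap S T) :
    ssmap (constant S) (constant T) :=
  @SSMap (constant S) (constant T) (fun=> f) _.
Next Obligation. by move=> *; apply: smap_ext. Qed.

Definition sset_of_type (T : Type) : sset :=
  @SSet (fun=> T) (fun _ _ _ => id) (fun _ _ => erefl)
        (fun _ _ _ _ _ _ => erefl).

Definition sset_of_type_map (T U : Type) (f : T -> U) :
    smap (sset_of_type T) (sset_of_type U) :=
  @SMap (sset_of_type T) (sset_of_type U) (fun=> f) (fun _ _ _ _ => erefl).

(* (discrete S)_{kl} = S_k. *)
Program Definition discrete (S : sset) : sspace :=
  @SSpace (fun k => sset_of_type (S k))
          (fun m n a => sset_of_type_map (@act S m n a)) _ _.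
Next Obligation. by move=> S n; apply: smap_ext => l x /=; rewrite act_id. Qed.
Next Obligation.
by move=> S l m n b a; apply: smap_ext => k x /=; rewrite act_comp.
Qed.

Program Definition discrete_map (S T : sset) (f : smap S T) :
    ssmap (discrete S) (discrete T) :=
  @SSMap (discrete S) (discrete T) (fun k => sset_of_type_map (f k)) _.
Next Obligation.
by move=> S T f m n a; apply: smap_ext => k x /=; rewrite smap_nat.
Qed.

Definition map_act (X Y : sspace) m n (a : mono m n)
    (h : ssmap (ssprod X (constant (simplex n))) Y) :
    ssmap (ssprod X (constant (simplex m))) Y :=
  sscomp h (ssprod_map (ssid X) (constant_map (simplex_map a))).

Program Definition Map (X Y : sspace) : sset :=
  @SSet (fun n => ssmap (ssprod X (constant (simplex n))) Y)
        (@map_act X Y) _ _.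
Next Obligation.
move=> X Y n h; apply: ssmap_ext => k l [x f] /=.
by congr (h k l (_, _)); apply: mono_ext.
Qed.
Next Obligation.
move=> X Y l m n b a h; apply: ssmap_ext => k k' [x f] /=.
by congr (h k k' (_, _)); apply: mono_ext.
Qed.

Program Definition Map_pre (X Y Z : sspace) (f : ssmap X Y) :
    smap (Map Y Z) (Map X Z) :=
  @SMap (Map Y Z) (Map X Z)
    (fun n h => sscomp h (ssprod_map f (ssid (constant (simplex n))))) _.
Next Obligation. by move=> *; apply: ssmap_ext. Qed.

Definition F (n : nat) : sspace := discrete (simplex n).

Definition dF (n : nat) : sspace := discrete (boundary n).

Definition dF_incl n : ssmap (dF n) (F n) := discrete_map (boundary_incl n).

Definition spine_pred n k (f : simplex n k) : Prop := f ord_max - f ord0 <= 1.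

Lemma spine_closed n : act_closed (@spine_pred n).
Proof.
move=> l m a f; rewrite /spine_pred /=; apply: leq_trans.
by apply: leq_sub; apply: mono_homo; rewrite // -ltnS.
Qed.

Definition G (n : nat) : sspace := discrete (ssub (@spine_closed n)).

Definition G_incl n : ssmap (G n) (F n) := discrete_map (ssub_incl _).

Record category := Category {
  ob :> Type;
  hom : ob -> ob -> Type;
  idm : forall x, hom x x;
  comp : forall x y z, hom y z -> hom x y -> hom x z;
  comp1m : forall x y (f : hom x y), comp (idm y) f = f;
  compm1 : forall x y (f : hom x y), comp f (idm x) = f;
  compA : forall w x y z (h : hom y z) (g : hom x y) (f : hom w x),
    comp h (comp g f) = comp (comp h g) f }.

Record functor (C D : category) := Functor {
  fob :> C -> D;
  fmor : forall x y, hom x y -> hom (fob x) (fob y);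
  fmor_id : forall x, fmor (idm x) = idm (fob x);
  fmor_comp : forall x y z (g : hom y z) (f : hom x y),
    fmor (comp g f) = comp (fmor g) (fmor f) }.

Lemma functor_ext (C D : category) (f : C -> D)
    (m1 m2 : forall x y : C, hom x y -> hom (f x) (f y)) i1 i2 c1 c2 : (forall x y (h : hom x y), m1 x y h = m2 x y h) ->
  @Functor C D f m1 i1 c1 = @Functor C D f m2 i2 c2.
Proof.
move=> e; have {}e : m1 = m2.
  apply: functional_extensionality_dep => x.
  by apply: functional_extensionality_dep => y; apply/funext/e.
case: m2 / e i2 c2 => i2 c2.
by rewrite (Prop_irrelevance i1 i2) (Prop_irrelevance c1 c2).
Qed.

Program Definition fcomp C D E (g : functor D E) (f : functor C D) :
    functor C E :=
  @Functor C E (fun x => g (f x)) (fun x y h => fmor g (fmor f h)) _ _.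
Next Obligation. by move=> * /=; rewrite !fmor_id. Qed.
Next Obligation. by move=> * /=; rewrite !fmor_comp. Qed.

Program Definition ordcat (n : nat) : category :=
  @Category 'I_n.+1 (fun i j => is_true (i <= j)) (fun i => leqnn i)
    (fun i j k hjk hij => leq_trans hij hjk) _ _ _.
Next Obligation. by move=> *; apply: bool_irrelevance. Qed.
Next Obligation. by move=> *; apply: bool_irrelevance. Qed.
Next Obligation. by move=> *; apply: bool_irrelevance. Qed.

Program Definition ordfun m n (a : mono m n) : functor (ordcat m) (ordcat n) :=
  @Functor (ordcat m) (ordcat n) a (fun i j h => mono_homo a h) _ _.
Next Obligation. by move=> *; apply: bool_irrelevance. Qed.
Next Obligation. by move=> *; apply: bool_irrelevance. Qed.

Program Definition nerve_sset (C : category) : sset :=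
  @SSet (fun k => functor (ordcat k) C) (fun _ _ a f => fcomp f (ordfun a)) _ _.
Next Obligation.
move=> C n [f m i c]; apply: functor_ext => x y h /=.
by congr (m x y _); apply: bool_irrelevance.
Qed.
Next Obligation.
move=> C k l n b a [f m i c]; apply: functor_ext => x y h /=.
by congr (m _ _ _); apply: bool_irrelevance.
Qed.

Definition nerve (C : category) : sspace := discrete (nerve_sset C).

Program Definition I_cat : category :=
  @Category bool (fun _ _ => unit) (fun=> tt) (fun _ _ _ _ _ => tt) _ _ _.
Next Obligation. by move=> _ _ []. Qed.
Next Obligation. by move=> _ _ []. Qed.
Next Obligation. by []. Qed.

Program Definition const_functor (C D : category) (d : D) : functor C D :=
  @Functor C D (fun=> d) (fun _ _ _ => idm d) _ _.
Next Obligation. by []. Qed.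
Next Obligation. by move=> *; rewrite comp1m. Qed.

(* The map F(0) -> N C picking out x: it sends the unique [k] -> [0] to the
   constant functor at x. *)
Program Definition nerve_point (C : category) (x : C) : ssmap (F 0) (nerve C) :=
  @discrete_map (simplex 0) (nerve_sset C)
    (@SMap (simplex 0) (nerve_sset C) (fun k _ => const_functor (ordcat k) x) _).
Next Obligation. by move=> *; apply: functor_ext. Qed.

Definition reedy_fibrant (W : sspace) : Prop :=
  forall n, kan_fibration (@Map_pre (dF n) (F n) W (dF_incl n)).

Definition segal (W : sspace) : Prop :=
  forall n, 2 <= n -> kan_equivalence (@Map_pre (G n) (F n) W (G_incl n)).

(* By the symmetry of I the condition does not depend on the chosen object. *)
Definition complete (W : sspace) : Prop :=
  forall x : I_cat,
    kan_equivalence (@Map_pre (F 0) (nerve I_cat) W (nerve_point x)).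

Definition complete_segal_space (W : sspace) : Prop :=
  [/\ reedy_fibrant W, segal W & complete W].

(* [n]^op is identified with [n] through the order reversal rev_ord. *)
Program Definition mop m n (a : mono m n) : mono m n :=
  @Mono m n (fun i => rev_ord (a (rev_ord i))) _.
Next Obligation.
move=> m n a i j ij /=; apply: leq_sub2l; rewrite ltnS.
by apply: mono_homo; rewrite /= leq_sub2l.
Qed.

(* The join of [m] and [n] is [m + n + 1]; its elements are split as
   'I_(m.+1 + n.+1), which is convertible to 'I_(m + n.+1).+1. *)
Definition join_fun m n m' n' (a : mono m m') (b : mono n n')
    (i : 'I_(m.+1 + n.+1)) : 'I_(m'.+1 + n'.+1) :=
  match split i with
  | inl j => lshift n'.+1 (a j)
  | inr j => rshift m'.+1 (b j)
  end.

Lemma join_homo m n m' n' (a : mono m m') (b : mono n n')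
  (i j : 'I_(m.+1 + n.+1)) : i <= j -> join_fun a b i <= join_fun a b j.
Proof.
rewrite /join_fun; case: (splitP i) => k ->; case: (splitP j) => l -> /=.
- exact: mono_homo.
- by move=> _; apply/ltnW/ltn_addr.
- by move=> h; have := leq_ltn_trans h (ltn_ord l); rewrite ltnNge leq_addr.
- by rewrite !leq_add2l; apply: mono_homo.
Qed.

Definition mjoin m n m' n' (a : mono m m') (b : mono n n') :
    mono (m + n.+1) (m' + n'.+1) :=
  @Mono (m + n.+1) (m' + n'.+1) (join_fun a b) (@join_homo m n m' n' a b).

(* Q([n]) = [n]^op * [n] = [2n+1]. *)
Definition Qob (n : nat) : nat := n + n.+1.

Definition Qmor m n (a : mono m n) : mono (Qob m) (Qob n) := mjoin (mop a) a.

Lemma join_fun_id m n (i : 'I_(m.+1 + n.+1)) :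
  join_fun (mid m) (mid n) i = i.
Proof.
by rewrite /join_fun; case: (splitP i) => j e; apply: val_inj; rewrite /= e.
Qed.

Lemma join_fun_comp m n m' n' m'' n'' (b : mono m' m'') (a : mono m m')
    (b' : mono n' n'') (a' : mono n n') (i : 'I_(m.+1 + n.+1)) :
  join_fun (mcomp b a) (mcomp b' a') i = join_fun b b' (join_fun a a' i).
Proof.
rewrite /join_fun; case: (split i) => j.
  by rewrite -[lshift n'.+1 _]/(unsplit (inl _)) unsplitK.
by rewrite -[rshift m'.+1 _]/(unsplit (inr _)) unsplitK.
Qed.

Lemma mop_id n : mop (mid n) = mid n.
Proof. by apply: mono_ext => i /=; rewrite rev_ordK. Qed.

Lemma mop_comp l m n (b : mono m n) (a : mono l m) :
  mop (mcomp b a) = mcomp (mop b) (mop a).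
Proof. by apply: mono_ext => i /=; rewrite rev_ordK. Qed.

Lemma Qmor_id n : Qmor (mid n) = mid (Qob n).
Proof. by rewrite /Qmor mop_id; apply: mono_ext; apply: join_fun_id. Qed.

Lemma Qmor_comp l m n (b : mono m n) (a : mono l m) :
  Qmor (mcomp b a) = mcomp (Qmor b) (Qmor a).
Proof. by rewrite /Qmor mop_comp; apply: mono_ext; apply: join_fun_comp. Qed.

Program Definition Tw (W : sspace) : sspace :=
  @SSpace (fun n => W (Qob n)) (fun m n a => sact W (Qmor a)) _ _.
Next Obligation. by move=> W n /=; rewrite Qmor_id sact_id. Qed.
Next Obligation. by move=> W l m n b a /=; rewrite Qmor_comp sact_comp. Qed.

(* Main.v *)
Set Warnings "-notation-overridden".
From mathcomp Require Import all_boot.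
From mathcomp Require Import boolp zify.
From mathcomp Require classical_sets.
From Stdlib Require Import Relation_Operators.
Require Import Defs.

Set Implicit Arguments.
Unset Strict Implicit.
Unset Printing Implicit Defensive.

(** Since [Tw W] is [W] precomposed with the doubling functor
    [n] |-> [n]^op * [n], each condition on [Tw W] concerns restriction of maps
    into [W] along an inclusion of subcomplexes of a doubled simplex, or of the
    pieces from which the nerve of the free isomorphism is built.

    For an inclusion [i] of simplicial sets, regarded as discrete simplicial
    spaces, and an inclusion [j] of spaces, lifting [Map_pre W i] against [j] is
    the same as lifting [col_pre j W] against [i] ([rlp_Map_col]).  So [W] may be
    replaced by a single map [q] of simplicial sets, with [j] a horn or a boundary
    inclusion, and the question becomes which inclusions [q] lifts against.
    Reedy fibrancy says that the [q] of a horn is a trivial fibration, hence lifts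
    against every inclusion ([triv_fib_lifts]); in particular all spaces of maps
    in question are Kan complexes and all restrictions Kan fibrations.  A Kan
    fibration of Kan complexes that is an equivalence is a trivial fibration
    ([kan_equivalence_triv_fib]), and conversely
    ([triv_fib_kan_equivalence]); so the Segal and completeness conditions say
    that the [q] of a boundary lifts against spines and against a vertex of the
    nerve [NI].  The inclusions against which these [q] lift ([good]) are closed
    under attaching cells ([lifts_attach]), and, by two-out-of-three, under right
    cancellation ([good_cancel]).

    A map lifts against [K] after the twisted arrow construction as soon as it
    lifts against the double of [K] ([sTw_rlp]).  This settles Reedy fibrancy.
    For the Segal condition, the double of the spine of [n] is a union of [n]
    tetrahedra inside the doubled simplex; it arises from the spine of the latter
    by attaching each tetrahedron along its own spine, so its inclusion is good
    by cancellation ([good_doubled_spine]).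

    For completeness, twisted arrows have two ends, in [X^op] and in [X], and the
    map from [Tw X] to its ends is a left fibration relative to [q]
    ([ends_rlp]): the double of the horn at 0, together with the two ends of the
    doubled simplex, is again a good subcomplex ([good_ends]).  As [NI] is
    obtained from a vertex by attaching simplices along their horns at 0
    ([NI_lifts]), a diagram of shape [NI] lifts to [Tw X] once its two ends lift,
    and these lift because [W] is complete ([sTw_NI_rlp]). *)

(** * Monotone maps *)

Lemma mcompE l m n (b : mono m n) (a : mono l m) i : mcomp b a i = b (a i).
Proof. by []. Qed.

Lemma mono_eq m n (a b : mono m n) : (forall i, val (a i) = val (b i)) -> a = b.
Proof. by move=> e; apply: mono_ext => i; apply: val_inj. Qed.

Lemma mono_eqP m n (a b : mono m n) i : a = b -> a i = b i.
Proof. by move->. Qed.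

Lemma mcompA k l m n (c : mono m n) (b : mono l m) (a : mono k l) :
  mcomp c (mcomp b a) = mcomp (mcomp c b) a.
Proof. exact: mono_ext. Qed.

Lemma mcomp1m m n (a : mono m n) : mcomp (mid n) a = a.
Proof. exact: mono_ext. Qed.

Lemma mcompm1 m n (a : mono m n) : mcomp a (mid m) = a.
Proof. exact: mono_ext. Qed.

Lemma mcomp_inj l m n (g : mono m n) (a b : mono l m) :
  injective g -> mcomp g a = mcomp g b -> a = b.
Proof.
move=> inj_g e; apply: mono_ext => i; apply: inj_g.
exact: (mono_eqP i e).
Qed.

Lemma mono_reflect_lt m n (g : mono m n) i j : g i < g j -> i < j.
Proof. by apply: contraTltn => h; rewrite -leqNgt; apply: mono_homo. Qed.

(** Any choice of preimages that depends only on the value is monotone, since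
    a monotone map reflects the strict order. *)
Lemma mono_factor k l n (f : mono k n) (g : mono l n) :
  (forall i, exists j, g j = f i) -> exists h : mono k l, f = mcomp g h.
Proof.
move=> fg; pose h i := odflt ord0 [pick j | g j == f i].
have gh i : g (h i) = f i.
  rewrite /h; case: pickP => [j /eqP //|no]; have [j e] := fg i.
  by move: (no j); rewrite e eqxx.
have hh (i j : 'I_k.+1) : i <= j -> h i <= h j.
  move/(mono_homo f); rewrite leq_eqVlt => /orP[/eqP/val_inj e|lt].
    by rewrite /h e.
  by apply/ltnW/(mono_reflect_lt (g := g)); rewrite !gh.
by exists (Mono hh); apply: mono_ext => i; rewrite /= gh.
Qed.

Lemma surj_section k n (a : mono k n) i0 : (forall j, exists i, a i = j) ->
  exists d : mono n k, mcomp a d = mid n /\ d (a i0) = i0.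
Proof.
move=> sa; pose h j := if j == a i0 then i0 else odflt ord0 [pick i | a i == j].
have ah j : a (h j) = j.
  rewrite /h; case: eqP => [-> //|_]; case: pickP => [i /eqP //|no].
  by have [i e] := sa j; move: (no i); rewrite e eqxx.
have hh (i j : 'I_n.+1) : i <= j -> h i <= h j.
  rewrite leq_eqVlt => /orP[/eqP/val_inj -> //|lt].
  by apply/ltnW/(mono_reflect_lt (g := a)); rewrite !ah.
exists (Mono hh); split; first by apply: mono_ext => j /=.
by rewrite /= /h eqxx.
Qed.

(** A surjective monotone map cannot jump by more than 1. *)
Lemma surj_le n (e : mono n n) : (forall j, exists i, e i = j) ->
  forall i, e i <= i.
Proof.
move=> se [i lti]; elim: i lti => [|i IH] lti /=.
  have [j ej] := se ord0; rewrite leqn0 -leqn0 -[X in _ <= X]/(val (@ord0 n)).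
  by rewrite -ej; apply: mono_homo.
have lti' : i < n.+1 by apply: ltnW.
rewrite leqNgt; apply/negP => lt; have [j ej] := se (Ordinal lti).
have := IH lti' => /= IHi.
case: (leqP j i) => ji.
  have /(mono_homo e) : j <= Ordinal lti' by [].
  by rewrite ej /= => /leq_trans/(_ IHi); rewrite ltnn.
have /(mono_homo e) : Ordinal lti <= j by [].
by rewrite ej /= leqNgt lt.
Qed.

Lemma surj_endo_id n (e : mono n n) : (forall j, exists i, e i = j) -> e = mid n.
Proof.
move=> se; apply: mono_eq => i /=; apply/eqP; rewrite eqn_leq surj_le //=.
have se' : forall j, exists i, mop e i = j.
  move=> j; have [i' ei] := se (rev_ord j); exists (rev_ord i').
  by rewrite /= rev_ordK ei rev_ordK.
have := surj_le se' (rev_ord i); rewrite /= rev_ordK !subSS => h.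
have := leq_sub2l n h; rewrite !subKn //; by rewrite -ltnS.
Qed.

Definition mlift n (j : 'I_n.+2) : mono n n.+1 :=
  @Mono n n.+1 (lift j) (fun i i' h => etrans (leq_bump2 j i i') h).

Lemma mlift_factor k n (a : mono k n.+1) j : (forall i, a i <> j) ->
  exists h : mono k n, a = mcomp (mlift j) h.
Proof.
move=> aj; apply: mono_factor => i; case: (unliftP j (a i)) => [i' e|e].
  by exists i'; rewrite e.
by case: (aj i).
Qed.

Lemma mlift_neq n (j : 'I_n.+2) i : mlift j i <> j.
Proof. by move/eqP; rewrite /= eq_sym (negbTE (neq_lift _ _)). Qed.

Lemma mlift_inj n (j : 'I_n.+2) : injective (mlift j).
Proof. exact: lift_inj. Qed.

(** The vertices outside [S] are deleted one at a time. *)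
Lemma mono_image n (S : 'I_n.+1 -> Prop) : (exists i, S i) ->
  exists l (g : mono l n), injective g /\ forall j, S j <-> exists i, g i = j.
Proof.
elim: n S => [|n IH] S [i0 Si0].
  exists 0, (mid 0); split=> // j; split=> [_|_]; first by exists j.
  by move: Si0; rewrite (ord1 i0) (ord1 j).
case: (pselect (forall i, S i)) => [all|/existsNP[j nSj]].
  by exists n.+1, (mid n.+1); split=> // j; split=> // _; exists j.
have [|l [g [inj_g gS]]] := IH (fun i => S (lift j i)).
  case: (unliftP j i0) => [i e|e]; first by exists i; rewrite -e.
  by move: Si0; rewrite e.
exists l, (mcomp (mlift j) g); split; first by apply: inj_comp; first exact: mlift_inj.
move=> i; split=> [Si|[i' <-]]; last by apply/gS; exists i'.
case: (unliftP j i) => [i' e|e]; last by move: Si; rewrite e.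
by move: Si; rewrite e => /gS[i'' <-]; exists i''.
Qed.

Lemma not_boundary_surj k n (a : mono k n) :
  ~ boundary_pred a -> forall j, exists i, a i = j.
Proof.
move=> na j; apply: contrapT => nj; apply: na; exists j => i e.
by apply: nj; exists i.
Qed.

(** * Partial maps and lifting problems *)

Definition spred (B : sset) := forall n, B n -> Prop.

Definition full (B : sset) : spred B := fun _ _ => True.
Arguments full : clear implicits.

Definition predU B (C D : spred B) : spred B := fun n b => C n b \/ D n b.

Definition simg A B (f : smap A B) : spred B := fun n b => exists a, f n a = b.

(** Partial maps are functional relations: no element of the target is needed
    where the map is undefined, extensions are inclusions of relations, and the
    union of a chain of partial maps is the union of relations. *)
Record pmap (B X : sset) (D : spred B) (U : forall n, B n -> X n -> Prop) :
    Prop := Pmap {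
  pmap_act : forall m n (a : mono m n) b x, U n b x -> U m (act a b) (act a x);
  pmap_fun : forall n b x x', U n b x -> U n b x' -> x = x';
  pmap_dom : forall n b, D n b <-> exists x, U n b x }.

(** The base map [V] may be defined on more than [D], so that a lifting problem
    for [C] and [E] is also one for [C] and any [D] in between. *)
Definition lifts X Y (p : smap X Y) B (C D : spred B) :=
  forall (U : forall n, B n -> X n -> Prop) (V : forall n, B n -> Y n -> Prop) E,
    pmap C U -> pmap E V ->
    (forall n b, D n b -> E n b) ->
    (forall n b x, U n b x -> V n b (p n x)) ->
  exists U', [/\ pmap D U', forall n b x, U n b x -> U' n b x
               & forall n b x, U' n b x -> V n b (p n x)].

Definition rlp X Y (p : smap X Y) A B (i : smap A B) :=
  forall (u : smap A X) (v : smap B Y), scomp p u = scomp v i ->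
  exists w : smap B X, scomp w i = u /\ scomp p w = v.

Lemma smap_congr X Y (f g : smap X Y) n x : f = g -> f n x = g n x.
Proof. by move->. Qed.

Lemma pmap_eq B (X : sset) (C D : spred B) (U : forall n, B n -> X n -> Prop) :
  (forall n b, C n b <-> D n b) -> pmap C U -> pmap D U.
Proof.
by move=> CD [hc hf hd]; split=> // n b; rewrite -CD.
Qed.

Lemma pmap_graph B X (f : smap B X) : pmap (full B) (fun n b x => f n b = x).
Proof.
split=> [m n a b x <-|n b x x' <- <- //|n b]; first exact: smap_nat.
by split=> // _; exists (f n b).
Qed.

Lemma pmap_inj K B X (i : smap K B) (u : smap K X) :
  (forall n, injective (i n)) ->
  pmap (simg i) (fun n b x => exists k, i n k = b /\ u n k = x).
Proof.
move=> inj_i; split=> [m n a b x [k [<- <-]]|n b x x' [k [<- <-]]|n b].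
- by exists (act a k); rewrite !smap_nat.
- by case=> k' [/inj_i -> <-].
- split=> [[k <-]|[x [k [<- _]]]]; last by exists k.
  by exists (u n k), k.
Qed.

Lemma pmap_pull A B X (D : spred B) U (f : smap A B) :
  @pmap B X D U -> pmap (fun n a => D n (f n a)) (fun n a x => U n (f n a) x).
Proof.
move=> [hc hf hd]; split=> [m n a b x|n b x x'|n b]; last exact: hd.
  by rewrite smap_nat; apply: hc.
exact: hf.
Qed.

Lemma pmap_smap B X (D : spred B) U : @pmap B X D U -> (forall n b, D n b) ->
  exists f : smap B X, forall n b, U n b (f n b).
Proof.
move=> [hc hf hd] tot.
have tot' n b : {x | U n b x} by apply: cid; apply/hd.
have nat m n (a : mono m n) b :
    sval (tot' m (act a b)) = act a (sval (tot' n b)).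
  apply: (hf _ (act a b)); first exact: (svalP (tot' _ _)).
  exact/hc/(svalP (tot' _ _)).
by exists (SMap nat) => n b /=; apply: (svalP (tot' _ _)).
Qed.

Lemma lifts_eq X Y (p : smap X Y) B (C C' D D' : spred B) :
  (forall n b, C n b <-> C' n b) -> (forall n b, D n b <-> D' n b) ->
  lifts p C D -> lifts p C' D'.
Proof.
move=> CC DD lCD U V E hU hV DE UV.
have [||U' [? ? ?]] := lCD U V E _ hV _ UV.
- by apply: pmap_eq hU => n b; rewrite CC.
- by move=> n b /DD/DE.
by exists U'; split=> //; apply: pmap_eq DD _.
Qed.

Lemma lifts_refl X Y (p : smap X Y) B (C : spred B) : lifts p C C.
Proof. by move=> U V E hU hV CE UV; exists U. Qed.

Lemma lifts_trans X Y (p : smap X Y) B (C D E : spred B) :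
  (forall n b, D n b -> E n b) -> lifts p C D -> lifts p D E -> lifts p C E.
Proof.
move=> DE lCD lDE U V F hU hV EF UV.
have [|U1 [hU1 s1 UV1]] := lCD U V F hU hV _ UV; first by move=> n b /DE/EF.
have [U2 [hU2 s2 UV2]] := lDE U1 V F hU1 hV EF UV1.
by exists U2; split=> // n b x /s1/s2.
Qed.

(** Attaching along [f]: lifts over the source of [f] transfer to lifts over
    the union with its image, because [f] is a relative isomorphism, i.e. it
    identifies nothing outside the part [S] that already lies in [C]. *)
Lemma lifts_attach X Y (p : smap X Y) A B (f : smap A B) (C : spred B)
    (S : spred A) :
  (forall n a, C n (f n a) <-> S n a) ->
  (forall n a a', f n a = f n a' -> S n a \/ a = a') ->
  lifts p S (full A) -> lifts p C (predU C (simg f)).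
Proof.
move=> CS inj lS U V E hU hV DE UV.
have hU0 : pmap S (fun n a x => U n (f n a) x).
  by apply: pmap_eq (pmap_pull f hU).
have [||U0 [hU0' s0 UV0]] := lS _ _ _ hU0 (pmap_pull f hV).
- by move=> n a _; apply: DE; right; exists a.
- by move=> n a x; apply: UV.
exists (fun n b x => U n b x \/ exists a, f n a = b /\ U0 n a x); split.
- split.
  + move=> m n a b x [h|[a' [<- h]]]; first by left; apply: (pmap_act hU).
    right; exists (act a a'); rewrite smap_nat; split=> //.
    exact: (pmap_act hU0').
  + have key n a x x' : U n (f n a) x -> U0 n a x' -> x = x'.
      by move=> /s0; apply: (pmap_fun hU0').
    move=> n b x x' [h|[a [ab h]]] [h'|[a' [ab' h']]].
    * exact: (pmap_fun hU) h h'.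
    * by move: h; rewrite -ab' => h; apply: key h h'.
    * by move: h'; rewrite -ab => h'; apply/esym; apply: key h' h.
    * have [Sa|e] := inj n a a' (etrans ab (esym ab')); last first.
        by move: h'; rewrite -e; apply: (pmap_fun hU0').
      have /(pmap_dom hU0)[y hy] := Sa.
      rewrite -(key _ _ _ _ hy h); apply: (key _ a') h'.
      by rewrite ab' -ab.
  + move=> n b; split=> [[/(pmap_dom hU)[x h]|[a <-]]|[x [h|[a [<- _]]]]].
    * by exists x; left.
    * have /(pmap_dom hU0')[x h] : full A n a by [].
      by exists x; right; exists a.
    * by left; apply/(pmap_dom hU); exists x.
    * by right; exists a.
- by move=> n b x h; left.
- by move=> n b x [/UV //|[a [<- /UV0]]].
Qed.

Lemma rlp_lifts X Y (p : smap X Y) A B (i : smap A B) :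
  (forall n, injective (i n)) -> rlp p i -> lifts p (simg i) (full B).
Proof.
move=> inj_i lp U V E hU hV DE UV.
have [|u hu] := pmap_smap (pmap_pull i hU); first by move=> n a; exists a.
have [|v hv] := pmap_smap hV; first by move=> n b; apply: DE.
have [|w [wi pw]] := lp u v.
  apply: smap_ext => n a; apply: (pmap_fun hV) (hv _ _).
  exact/UV/hu.
exists (fun n b x => w n b = x); split; first exact: pmap_graph.
- move=> n b x h; have /(pmap_dom hU)[a e] : exists x, U n b x by exists x.
  move: h; rewrite -e => h; rewrite (pmap_fun hU h (hu n a)).
  exact: smap_congr wi.
- by move=> n b x <-; rewrite -[p n _](smap_congr b (esym pw)); apply: hv.
Qed.

(** A lifting problem between two subcomplexes of [B] can be solved by relations
    on [B] itself. *)
Lemma lifts_rlp_sub X Y (p : smap X Y) K L B (i : smap K L) (f : smap L B) :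
  (forall n, injective (i n)) -> (forall n, injective (f n)) ->
  lifts p (simg (scomp f i)) (simg f) -> rlp p i.
Proof.
move=> inj_i inj_f lp u v puvi.
have inj_fi n : injective (scomp f i n).
  by move=> k k' /inj_f/inj_i.
have [||U [hU sU UV]] := lp _ _ _ (pmap_inj u inj_fi) (pmap_inj v inj_f).
- by [].
- move=> n b x [k [<- <-]]; exists (i n k); split=> //.
  exact: (smap_congr k (esym puvi)).
have [|w hw] := pmap_smap (pmap_pull f hU); first by move=> n l; exists l.
exists w; split; apply: smap_ext => n l /=.
  by apply: (pmap_fun hU) (hw n (i n l)) _; apply: sU; exists l.
by have /UV[l' [/inj_f -> ->]] := hw n l.
Qed.

Lemma lifts_rlp X Y (p : smap X Y) K L (i : smap K L) :
  (forall n, injective (i n)) -> lifts p (simg i) (full L) -> rlp p i.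
Proof.
move=> inj_i lp; apply: (lifts_rlp_sub (f := sid L)) => //; first by move=> n x y.
by apply: lifts_eq lp => // n b; split=> // _; exists b.
Qed.

(** * Countable and transfinite composition *)

(** The partial lifts are chosen successively, each extending the previous one,
    so that their union is single-valued. *)
Lemma lifts_chain X Y (p : smap X Y) B (C : nat -> spred B) :
  (forall k n b, C k n b -> C k.+1 n b) ->
  (forall k, lifts p (C k) (C k.+1)) ->
  (forall n b, exists k, C k n b) -> lifts p (C 0) (full B).
Proof.
move=> CS lC cov U V E hU hV DE UV.
pose T k := {U : forall n, B n -> X n -> Prop |
  pmap (C k) U /\ forall n b x, U n b x -> V n b (p n x)}.
have step k (t : T k) : {t' : T k.+1 |
    forall n b x, sval t n b x -> sval t' n b x}.
  apply: cid; have [hUk UVk] := svalP t.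
  have [|U' [h1 h2 h3]] := lC k _ _ _ hUk hV _ UVk.
    by move=> n b _; apply: DE.
  by exists (exist _ U' (conj h1 h3)).
pose t := fix t k : T k := if k is k'.+1 then sval (step k' (t k'))
                           else exist _ U (conj hU UV).
have tS k n b x : sval (t k) n b x -> sval (t k.+1) n b x.
  exact: (svalP (step k (t k))).
have tle k l n b x : k <= l -> sval (t k) n b x -> sval (t l) n b x.
  move/subnK <-; elim: (l - k) => [//|d IH] h.
  exact/tS/IH.
exists (fun n b x => exists k, sval (t k) n b x); split.
- split.
  + move=> m n a b x [k h]; exists k.
    exact: (pmap_act (proj1 (svalP (t k)))).
  + move=> n b x x' [k h] [k' h'].
    apply: (pmap_fun (proj1 (svalP (t (maxn k k'))))).
      by apply: tle h; apply: leq_maxl.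
    by apply: tle h'; apply: leq_maxr.
  + move=> n b; split=> // _; have [k] := cov n b.
    by move/(pmap_dom (proj1 (svalP (t k)))) => [x h]; exists x, k.
- by move=> n b x h; exists 0.
- by move=> n b x [k]; apply: (proj2 (svalP (t k))).
Qed.

Definition gen (B : sset) n (x : B n) : spred B :=
  fun m b => exists a : mono m n, b = act a x.

Lemma boundary_factor k n (a : mono k n) : boundary_pred a ->
  exists l (g : mono l n) (h : mono k l), l < n /\ a = mcomp g h.
Proof.
case: n a => [|n] a [j aj].
  by case: (aj ord0); rewrite (ord1 j) (ord1 (a _)).
by have [h e] := mlift_factor aj; exists n, (mlift j), h.
Qed.

(** Transfinite composition over the cells of [B], by Zorn's lemma applied to
    the partial lifts: a maximal one that is not total can be extended over a
    cell of minimal dimension outside its domain.  The cells of [B] parametrize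
    an extension of domains in [C], through [E D]; this covers the cells of [B]
    themselves as well as their products with an interval. *)
Lemma cell_induction X Y (p : smap X Y) B C (pi : smap C B) (C0 : spred C) :
  let E (D : spred B) : spred C := fun n c => C0 n c \/ D n (pi n c) in
  forall A : spred B, act_closed A ->
  (forall (D : spred B) n (x : B n), act_closed D -> ~ D n x ->
    (forall k (a : mono k n), boundary_pred a -> D k (act a x)) ->
    lifts p (E D) (E (predU D (gen x)))) ->
  lifts p (E A) (full C).
Proof.
move=> E A clA step U V F hU hV DF UV.
pose ok (t : spred B * (forall n, C n -> X n -> Prop)) :=
  [/\ act_closed t.1, forall n b, A n b -> t.1 n b, pmap (E t.1) t.2,
      forall n b x, U n b x -> t.2 n b x
    & forall n b x, t.2 n b x -> V n b (p n x)].
pose T := {t | ok t}.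
pose R (s t : T) := `[< (forall n b, (sval s).1 n b -> (sval t).1 n b) /\
  (forall n c x, (sval s).2 n c x -> (sval t).2 n c x) >].
have [||||t maxt] := @classical_sets.Zorn T R.
- by move=> t; apply/asboolP.
- move=> r s t /asboolP[h1 h2] /asboolP[h3 h4]; apply/asboolP.
  by split=> [n b /h1/h3|n c x /h2/h4].
- move=> [[D1 U1] ok1] [[D2 U2] ok2] /asboolP[/= h1 h2] /asboolP[/= h3 h4].
  apply: eq_exist; congr (_, _).
    apply: functional_extensionality_dep => n; apply/funext => b.
    by apply/propext; split=> [/h1|/h3].
  apply: functional_extensionality_dep => n; apply/funext => b.
  by apply/funext => x; apply/propext; split=> [/h2|/h4].
- move=> Ch totCh.
  pose D n b := A n b \/ exists2 t, Ch t & (sval t).1 n b.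
  pose W n c x := U n c x \/ exists2 t, Ch t & (sval t).2 n c x.
  have okW : ok (D, W).
    split=> /=.
    + move=> m n a b [h|[t Cht h]]; first by left; apply: clA.
      by right; exists t => //; case: (svalP t) => cl _ _ _ _; apply: cl.
    + by left.
    + split.
      * move=> m n a b x [h|[t Cht h]]; first by left; apply: (pmap_act hU).
        right; exists t => //; case: (svalP t) => _ _ hp _ _.
        exact: (pmap_act hp).
      * move=> n b x x' [h|[t Cht h]] [h'|[t' Cht' h']].
        - exact: (pmap_fun hU) h h'.
        - case: (svalP t') => _ _ hp UU _.
          by apply: (pmap_fun hp) h'; apply: UU.
        - case: (svalP t) => _ _ hp UU _.
          by apply: (pmap_fun hp) h _; apply: UU.
        - case: (totCh t t' Cht Cht') => /asboolP[_ s].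
            case: (svalP t') => _ _ hp UU _.
            by apply: (pmap_fun hp) h'; apply: s.
          case: (svalP t) => _ _ hp UU _.
          by apply: (pmap_fun hp) h _; apply: s.
      * have domU n c : E A n c -> exists x, W n c x.
          by move/(pmap_dom hU) => [x h]; exists x; left.
        move=> n c; split=> [[h|[h|[t Cht h]]]|[x [h|[t Cht h]]]].
        - by apply: domU; left.
        - by apply: domU; right.
        - case: (svalP t) => _ _ hp _ _.
          have /(pmap_dom hp)[x hx] : E (sval t).1 n c by right.
          by exists x; right; exists t.
        - have : E A n c by apply/(pmap_dom hU); exists x.
          by case=> [h'|h']; [left|right; left].
        - case: (svalP t) => _ _ hp _ _.
          have : E (sval t).1 n c by apply/(pmap_dom hp); exists x.
          by case=> [h'|h']; [left|right; right; exists t].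
    + by move=> n b x h; left.
    + move=> n b x [/UV //|[t Cht]].
      by case: (svalP t) => _ _ _ _; apply.
  exists (exist _ (D, W) okW) => t Cht; apply/asboolP; split=> /=.
    by move=> n b h; right; exists t.
  by move=> n c x h; right; exists t.
case: t maxt => [[D U'] /= okt] maxt; case: (okt) => /= clD AD hU' UU' UV'.
suff tot n b : D n b.
  by exists U'; split=> //; apply: pmap_eq hU' => n c; split=> // _; right.
elim/ltn_ind: n b => n IH b; apply: contrapT => nDb.
have bd k (a : mono k n) : boundary_pred a -> D k (act a b).
  case/boundary_factor => l [g [h [ln ->]]].
  by rewrite act_comp; apply: clD; apply: IH.
have [|U2 [hU2 s2 UV2]] := step D n b clD nDb bd U' V F hU' hV _ UV'.
  by move=> m c _; apply: DF.
have ok2 : ok (predU D (gen b), U2).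
  split=> //=.
  - move=> m k a x [h|[a' ->]]; first by left; apply: clD.
    by right; exists (mcomp a' a); rewrite act_comp.
  - by move=> m x h; left; apply: AD.
  - by move=> m c x /UU'/s2.
have Rt2 : R (exist _ (D, U') okt) (exist _ _ ok2).
  by apply/asboolP; split=> [m x h|//]; left.
have eD : predU D (gen b) = D := congr1 (fun t : T => (sval t).1) (maxt _ Rt2).
apply: nDb; rewrite -eD; right; exists (mid n).
by rewrite act_id.
Qed.

(** * Partial maps and lifting problems *)
(** * Trivial fibrations *)

Definition triv_fib X Y (p : smap X Y) := forall n, rlp p (boundary_incl n).

Definition yoneda (B : sset) n (x : B n) : smap (simplex n) B :=
  @SMap (simplex n) B (fun _ a => act a x) (fun _ _ a b => act_comp b a x).

Lemma sval_inj_ssub X P (hP : @act_closed X P) n : injective (ssub_incl hP n).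
Proof. by move=> [x hx] [y hy] /= e; apply: eq_exist. Qed.

Lemma simg_ssub X P (hP : @act_closed X P) n x :
  simg (ssub_incl hP) x <-> P n x.
Proof. by split=> [[[y hy] /= <-] //|h]; exists (exist _ x h). Qed.

Lemma rlp_lifts_ssub X Y (p : smap X Y) B P (hP : @act_closed B P) :
  rlp p (ssub_incl hP) -> lifts p P (full B).
Proof.
move/(rlp_lifts (@sval_inj_ssub _ _ hP)); apply: lifts_eq => // n b.
exact: simg_ssub.
Qed.

(** The cell [x] of [B] lies outside [D] and its boundary inside.  Then [x] is
    attached to [D] along its boundary: [D] contains no more faces of [x], and no
    two surjective images of [x] are identified. *)
Section MinimalCell.
Variables (B : sset) (D : spred B) (n : nat) (x : B n).
Hypotheses (clD : act_closed D) (nDx : ~ D x)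
  (bdD : forall k (a : mono k n), boundary_pred a -> D (act a x)).

Lemma minimal_cell_boundary k (a : mono k n) : D (act a x) <-> boundary_pred a.
Proof.
split=> [Da|]; last exact: bdD.
apply: contrapT => /not_boundary_surj sa.
have [i0 _] := sa ord0.
have [d [ad _]] := surj_section i0 sa; apply: nDx.
by rewrite -(act_id x) -ad act_comp; apply: clD.
Qed.

(** The Eilenberg-Zilber argument: if [s] and [t] are surjective with
    [act s x = act t x] and [d] is a section of [s], then [act (t d) x = x], so
    [t d] lies outside the boundary and is the identity; since the sections of
    [s] reach every point, this forces [s = t]. *)
Lemma minimal_cell_inj k (s t : mono k n) :
  act s x = act t x -> D (act s x) \/ s = t.
Proof.
move=> e; case: (pselect (boundary_pred s)) => [/bdD|/not_boundary_surj ss].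
  by left.
right; apply: mono_ext => i; have [d [sd di]] := surj_section i ss.
have td : mcomp t d = mid n.
  apply/surj_endo_id/not_boundary_surj => /bdD.
  by rewrite act_comp -e -act_comp sd act_id.
by rewrite -[in RHS]di -mcompE td.
Qed.

End MinimalCell.

Lemma triv_fib_lifts X Y (p : smap X Y) B (A : spred B) :
  triv_fib p -> act_closed A -> lifts p A (full B).
Proof.
move=> tp clA; have := @cell_induction _ _ p B B (sid B) (fun _ _ => False) A clA.
move=> H; apply: (lifts_eq _ _ (H _)) => //; first by move=> n b; split; [case|right].
move=> D n x clD nDx bd.
have L : lifts p D (predU D (simg (yoneda x))).
  apply: lifts_attach (rlp_lifts_ssub (tp n)) => [k a|k a a' /=].
    exact: minimal_cell_boundary.
  move=> e; have [h|] := minimal_cell_inj nDx bd e; last by right.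
  by left; apply/(minimal_cell_boundary clD nDx bd).
apply: lifts_eq L => m b; rewrite /predU /=.
  by split=> [h|[]//]; right.
split=> [[h|[a <-]]|[//|[h|[a ->]]]]; first by right; left.
- by right; right; exists a.
- by left.
- by right; exists a.
Qed.

Lemma simg_closed A B (i : smap A B) : act_closed (simg i).
Proof. by move=> m n a x [b <-]; exists (act a b); rewrite smap_nat. Qed.

Lemma triv_fib_rlp X Y (p : smap X Y) A B (i : smap A B) :
  triv_fib p -> (forall n, injective (i n)) -> rlp p i.
Proof.
by move=> tp inj_i; apply: lifts_rlp => //; apply: triv_fib_lifts => //; apply: simg_closed.
Qed.

(** * The homotopy lifting property of Kan fibrations *)

Definition cst k n (e : 'I_n.+1) : mono k n :=
  @Mono k n (fun=> e) (fun _ _ _ => leqnn e).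

Lemma mcomp_cst l k n (e : 'I_n.+1) (a : mono l k) : mcomp (cst k e) a = cst l e.
Proof. exact: mono_ext. Qed.

Definition I0 : 'I_2 := ord0.
Definition I1 : 'I_2 := ord_max.

Lemma I2P (t : 'I_2) : t = I0 \/ t = I1.
Proof. by case: t => [[|[|//]] h]; [left|right]; apply: val_inj. Qed.

Definition at_end B (e : 'I_2) : smap B (sprod B (simplex 1)).
refine (@SMap B (sprod B (simplex 1)) (fun k b => (b, cst k e)) _).
Proof. by move=> m n a x; congr (_, _); rewrite /= mcomp_cst. Defined.

(** First coordinate of the nondegenerate simplex
    (0,0), ..., (i,0), (i,1), ..., (n,1) of the prism. *)
Definition prism_fst n (i : 'I_n.+1) : mono n.+1 n.
refine (@Mono n.+1 n (fun x => inord (if x <= i then x : nat else x.-1)) _).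
Proof.
move=> x y xy; have h (z : 'I_n.+2) : (if z <= i then z : nat else z.-1) < n.+1.
  case: (leqP z i) => zi; first exact: leq_ltn_trans zi (ltn_ord i).
  by have := ltn_ord z; case: (val z) zi.
rewrite !inordK //; case: (leqP x i) => xi; case: (leqP y i) => yi //.
- by have := leq_ltn_trans xi yi; case: (val y).
- by have := leq_trans xi (leq_trans xy yi); rewrite ltnn.
- by case: (val x) (val y) xy => [|x'] [|y'].
Defined.

Definition prism_snd n (i : 'I_n.+1) : mono n.+1 1.
refine (@Mono n.+1 1 (fun x => if x <= i then I0 else I1) _).
Proof.
move=> x y xy; case: (leqP x i) => xi //; case: (leqP y i) => yi //.
by have := leq_trans xi (leq_trans xy yi); rewrite ltnn.
Defined.

Lemma prism_fstE n (i : 'I_n.+1) x :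
  val (prism_fst i x) = if x <= i then val x else x.-1.
Proof.
rewrite /= inordK //; case: (leqP x i) => xi.
  exact: leq_ltn_trans xi (ltn_ord i).
by have := ltn_ord x; case: (val x) xi.
Qed.

(** The simplices of the prism are attached in decreasing order, from [n] to 0;
    the third clause says that [c] lies in the simplex number [j]. *)
Definition prism_stage n (i : nat) : spred (sprod (simplex n) (simplex 1)) :=
  fun k c => [\/ boundary_pred c.1, forall x, c.2 x = I0
    | exists2 j : 'I_n.+1, i <= j &
        forall x, if c.2 x == I0 then c.1 x <= j else j <= c.1 x].
Arguments prism_stage : clear implicits.

Definition prism n (i : 'I_n.+1) :
  smap (simplex n.+1) (sprod (simplex n) (simplex 1)).
refine (@SMap (simplex n.+1) (sprod (simplex n) (simplex 1))
  (fun k a => (mcomp (prism_fst i) a, mcomp (prism_snd i) a)) _).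
Proof. by move=> l k a b; congr (_, _); apply: mono_ext. Defined.

Lemma prism_inj n (i : 'I_n.+1) k : injective (prism i k).
Proof.
move=> a b e; have e1 := congr1 fst e; have e2 := congr1 snd e.
apply: mono_ext => x; apply: val_inj.
have := congr1 val (mono_eqP x e1); rewrite !mcompE !prism_fstE.
have := mono_eqP x e2; rewrite /=.
case: (leqP (a x) i) => ai; case: (leqP (b x) i) => bi //= _.
by case: (val (a x)) (val (b x)) ai bi => [|x1] [|x2] //= _ _ ->.
Qed.

(** The stage [i.+1] meets the simplex [prism i] in its horn at [i]: the face
    opposite to [i.+1] is at the end 0 or shared with the next simplex, the
    face opposite to [i] is free, and the other faces lie over the boundary. *)
Lemma prism_stage_horn n (i : 'I_n.+1) k (a : simplex n.+1 k) :
  prism_stage n i.+1 k (prism i k a) <-> horn_pred (widen_ord (leqnSn _) i) a.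
Proof.
set r := widen_ord _ _; split.
- case=> [[c hc]|at0|[j ij hj]].
  + case: (ltngtP c i) => ci.
    * exists (widen_ord (leqnSn _) c).
        by move/(congr1 val) => /= e; move: ci; rewrite e ltnn.
      move=> x ax; apply: (hc x); apply: val_inj.
      by rewrite mcompE prism_fstE ax /= ltnW.
    * exists (lift ord0 c).
        by move/(congr1 val) => /= e; move: ci; rewrite -e /bump /= ltnNge leqnSn.
      move=> x ax; apply: (hc x); apply: val_inj.
      by rewrite mcompE prism_fstE ax /= /bump /= add1n leqNgt ltnS ltnW.
    * exists (lift ord0 i).
        by move/(congr1 val) => /= e; have := ltnn i; rewrite -{2}e /bump /= add1n leqnn.
      move=> x ax; apply: (hc x); apply: val_inj.
      by rewrite mcompE prism_fstE ax /= /bump /= add1n ltnn.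
  + exists (lift ord0 i).
      by move/(congr1 val) => /= e; have := ltnn i; rewrite -{2}e /bump /= add1n leqnn.
    move=> x ax; have := at0 x.
    by rewrite /= ax /= /bump /= add1n ltnn.
  + exists (lift ord0 i).
      by move/(congr1 val) => /= e; have := ltnn i; rewrite -{2}e /bump /= add1n leqnn.
    move=> x ax; have := hj x.
    have := prism_fstE i (a x); rewrite /= => ->.
    by rewrite /= ax /= /bump /= add1n ltnn /= leqNgt ij.
- case=> c cr hc; case: (ltngtP c i) => ci.
  + constructor 1; exists (Ordinal (ltn_trans ci (ltn_ord i))) => x /(congr1 val).
    rewrite [LHS]prism_fstE /=.
    case: (leqP (a x) i) => ai e; first by apply: (hc x); apply: val_inj.
    move: ai ci; rewrite -e; case: (val (a x)) => //= y; rewrite ltnS.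
    by move=> /leq_ltn_trans h /h; rewrite ltnn.
  + case: (ltngtP c i.+1) => ci1.
    * by move: ci; rewrite ltnNge -ltnS ci1.
    * have c0 : 0 < c by apply: leq_trans ci.
      have cn : c.-1 < n.+1 by have := ltn_ord c; case: (val c) c0.
      constructor 1; exists (Ordinal cn) => x /(congr1 val).
      rewrite [LHS]prism_fstE /=.
      case: (leqP (a x) i) => ai e.
        by move: ci1; rewrite -(prednK c0) ltnS -e ltnNge ai.
      apply: (hc x); apply: val_inj => /=; rewrite -(prednK c0) -e prednK //.
      exact: leq_trans ai.
    * case: (ltnP i.+1 n.+1) => iN; last first.
        constructor 2 => x /=; case: (leqP (a x) i) => // ai.
        case: (hc x); apply: val_inj; rewrite /= ci1; apply/eqP.
        by rewrite eqn_leq ai andbT (leq_trans _ iN) // -ltnS.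
      constructor 3; exists (Ordinal iN) => //= x.
      have := prism_fstE i (a x); rewrite /= => ->.
      case: (leqP (a x) i) => ai /=; first exact: ltnW.
      have : a x != i.+1 :> nat.
        by apply/eqP => e; apply: (hc x); apply: val_inj; rewrite /= ci1.
      by move: ai; case: (val (a x)) => //= y; rewrite ltnS eqSS leq_eqVlt eq_sym => /orP[->|].
  + by case: cr; apply: val_inj.
Qed.

Lemma prism_stage_step n (i : 'I_n.+1) k c :
  prism_stage n i k c <->
  predU (prism_stage n i.+1) (simg (prism i)) c.
Proof.
split.
- case=> [h|h|[j ij hj]]; [by left; constructor 1|by left; constructor 2|].
  move: ij; rewrite leq_eqVlt => /orP[/eqP/val_inj ij|ij]; last first.
    by left; constructor 3; exists j.
  right; rewrite -{j}ij in hj.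
  have g (x : 'I_k.+1) : (if c.2 x == I0 then val (c.1 x) else (c.1 x).+1) < n.+2.
    have h := ltn_ord (c.1 x).
    by case: ifP => _; rewrite ltnS // ltnW.
  have hg (x y : 'I_k.+1) : x <= y -> Ordinal (g x) <= Ordinal (g y).
    move=> xy /=; have h1 := mono_homo c.1 xy; have h2 := mono_homo c.2 xy.
    case: ifP => c1; case: ifP => c2 //; first exact: leq_trans h1 _.
    by move: c1 h2; rewrite (eqP c2); case: (I2P (c.2 x)) => ->.
  exists (Mono hg); case: c hj g hg => c1 c2 /= hj g hg.
  congr (_, _); last first.
    apply: mono_ext => x /=; move: (hj x).
    case: (I2P (c2 x)) => -> /=; first by move->.
    by rewrite ltnNge => ->.
  apply: mono_eq => x; rewrite mcompE prism_fstE /=; move: (hj x).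
  case: (I2P (c2 x)) => -> /=; first by move->.
  by rewrite ltnNge => ->.
- case=> [[h|h|[j ij hj]]|[a <-]].
  + by constructor 1.
  + by constructor 2.
  + by constructor 3; exists j => //; apply: ltnW.
  + constructor 3; exists i => // x; have := prism_fstE i (a x); rewrite /= => ->.
    case: (leqP (a x) i) => ai //=.
    by move: ai; case: (val (a x)).
Qed.

Lemma prism_stage0 n k c : prism_stage n 0 k c.
Proof.
case: (pselect (exists x, c.2 x == I1)) => [[x0 h0]|no]; last first.
  by constructor 2 => x; case: (I2P (c.2 x)) => // e; case: no; exists x; rewrite e.
have [x1 h1 min1] := @arg_minnP _ x0 (fun x => c.2 x == I1) val h0.
(* The number of the simplex is read off at the first vertex in the end 1. *)
constructor 3; exists (c.1 x1) => // x; case: (I2P (c.2 x)) => e; rewrite e /=.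
  apply: mono_homo; rewrite leqNgt; apply/negP => /ltnW/(mono_homo c.2).
  by rewrite (eqP h1) e.
by apply/mono_homo/min1; rewrite e.
Qed.

(** The inclusion of the open prism is a composite of horn attachments. *)
Lemma prism_lifts X Y (p : smap X Y) n : kan_fibration p ->
  lifts p (prism_stage n n.+1) (full _).
Proof.
move=> kp; suff H i : i <= n.+1 -> lifts p (prism_stage n n.+1) (prism_stage n i).
  by apply: lifts_eq (H 0 _) => // k c; split=> // _; apply: prism_stage0.
move=> ile; rewrite -(subKn ile); elim: (n.+1 - i) => [|d IH].
  by rewrite subn0; apply: lifts_refl.
case: (ltnP d n.+1) => dn; last first.
  suff -> : n.+1 - d.+1 = n.+1 - d by [].
  have -> : n.+1 - d = 0 by apply/eqP; rewrite subn_eq0.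
  by apply/eqP; rewrite subn_eq0 leqW.
have iN : n.+1 - d.+1 < n.+1 by rewrite subSS ltnS leq_subr.
have e : (n.+1 - d.+1).+1 = n.+1 - d by rewrite subSS subSn.
apply: lifts_trans IH _; rewrite -e.
  by move=> k c h; apply/(prism_stage_step (Ordinal iN)); left.
have L : lifts p (prism_stage n (Ordinal iN).+1)
    (predU (prism_stage n (Ordinal iN).+1) (simg (prism (Ordinal iN)))).
  apply: lifts_attach (rlp_lifts_ssub (kp n (widen_ord (leqnSn _) (Ordinal iN)))).
    by move=> k a; apply: prism_stage_horn.
  by move=> k a a' /prism_inj; right.
by apply: lifts_eq L => // k c; rewrite -prism_stage_step.
Qed.

(** * Partial maps and lifting problems *)
Lemma scompA W X Y Z (h : smap Y Z) (g : smap X Y) (f : smap W X) :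
  scomp h (scomp g f) = scomp (scomp h g) f.
Proof. exact: smap_ext. Qed.

Lemma scompf1 X Y (f : smap X Y) : scomp f (sid X) = f.
Proof. exact: smap_ext. Qed.

Lemma scomp1f X Y (f : smap X Y) : scomp (sid Y) f = f.
Proof. exact: smap_ext. Qed.

(** Cell by cell in [B], the open cylinder is filled by filling open prisms. *)
Lemma interval_lifts X Y (p : smap X Y) B (A : spred B) :
  kan_fibration p -> act_closed A ->
  lifts p (fun k (c : sprod B (simplex 1) k) => (forall x, c.2 x = I0) \/ A k c.1)
    (full _).
Proof.
move=> kp clA.
pose pi : smap (sprod B (simplex 1)) B :=
  @SMap (sprod B (simplex 1)) B (fun _ c => c.1) (fun _ _ _ _ => erefl).
apply: (@cell_induction _ _ p B (sprod B (simplex 1)) pi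
  (fun k c => forall x, c.2 x = I0) A clA).
move=> D n x clD nDx bd.
have L : lifts p (fun k (c : sprod B (simplex 1) k) => (forall x, c.2 x = I0) \/ D k c.1)
   (predU (fun k (c : sprod B (simplex 1) k) => (forall x, c.2 x = I0) \/ D k c.1)
      (simg (sprod_map (yoneda x) (sid (simplex 1))))).
  apply: lifts_attach (@prism_lifts _ _ p n kp).
    move=> k [a t] /=; split=> [[h|h]|[h|h|[j nj _]]]; first by constructor 2.
    - by constructor 1; apply/(minimal_cell_boundary clD nDx bd).
    - by right; apply: bd.
    - by left.
    - by move: nj; rewrite leqNgt ltn_ord.
  move=> k [a t] [a' t'] e.
  have e1 : act a x = act a' x := congr1 fst e.
  have e2 : t = t' := congr1 snd e; rewrite -e2.
  have [h|->] := minimal_cell_inj nDx bd e1; last by right.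
  by left; constructor 1; apply/(minimal_cell_boundary clD nDx bd).
apply: lifts_eq L => // k [b t] /=.
split=> [[[h|h]|[[a t'] e]]|[h|[h|[a /= e]]]].
- by left.
- by right; left.
- by right; right; exists a; rewrite -[LHS]/((b, t).1) -e.
- by left; left.
- by left; right.
- by right; exists (a, t); rewrite e.
Qed.

Lemma homotopy_lifting X Y (p : smap X Y) K B (i : smap K B) (f : smap B X)
    (H : smap (sprod B (simplex 1)) Y) (G : smap (sprod K (simplex 1)) X) :
  kan_fibration p -> (forall n, injective (i n)) ->
  scomp p f = scomp H (at_end B I0) ->
  scomp p G = scomp H (sprod_map i (sid _)) ->
  scomp G (at_end K I0) = scomp f i ->
  exists H' : smap (sprod B (simplex 1)) X,
    [/\ scomp p H' = H, scomp H' (at_end B I0) = f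
      & scomp H' (sprod_map i (sid _)) = G].
Proof.
move=> kp inj_i pf pG Gf.
pose U k (c : sprod B (simplex 1) k) x :=
  (c.2 = cst k I0 /\ f k c.1 = x) \/ exists a, i k a = c.1 /\ G k (a, c.2) = x.
have key k (c : sprod B (simplex 1) k) a : i k a = c.1 -> c.2 = cst k I0 ->
    G k (a, c.2) = f k c.1.
  by move=> <- ->; apply: (smap_congr a Gf).
have hU : pmap (fun k (c : sprod B (simplex 1) k) =>
    (forall x, c.2 x = I0) \/ simg i c.1) U.
  split.
  - move=> m n a c x [[e <-]|[b [e <-]]]; [left|right].
      by rewrite smap_nat /= e mcomp_cst.
    by exists (act a b); rewrite smap_nat e -smap_nat.
  - move=> n c x x' [[e <-]|[a [e <-]]] [[e' <-]|[a' [e' <-]]] //.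
    + by rewrite key.
    + by rewrite key.
    + by move: e'; rewrite -e => /inj_i ->.
  - move=> n c; split=> [[e|[a e]]|[x [[e _]|[a [e _]]]]].
    + exists (f n c.1); left; split=> //; exact: mono_ext.
    + by exists (G n (a, c.2)); right; exists a.
    + by left; rewrite e.
    + by right; exists a.
have [||U' [hU' sU UV]] := interval_lifts kp (@simg_closed _ _ i) hU (pmap_graph H).
- by [].
- move=> n c x [[e <-]|[a [e <-]]].
    by rewrite -[p n _]/(scomp p f n _) pf /= -e; case: (c).
  by rewrite -[p n _]/(scomp p G n _) pG /= e; case: (c).
have [|H' hH'] := pmap_smap hU'; first by [].
exists H'; split; apply: smap_ext => n c /=.
- exact/esym/UV/hH'.
- by apply: (pmap_fun hU') (hH' _ _) _; apply: sU; left.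
- by apply: (pmap_fun hU') (hH' _ _) _; apply: sU; right; exists c.1; case: c.
Qed.

(** * Homotopies *)

Definition pt : sset := sset_of_type unit.
Definition empty : sset := sset_of_type False.

Definition from_empty X : smap empty X :=
  @SMap empty X (fun _ (x : False) => match x with end)
    (fun _ _ _ (x : False) => match x with end).

Definition to_pt X : smap X pt := @SMap X pt (fun _ _ => tt) (fun _ _ _ _ => erefl).

Lemma kan_to_pt X : kan_complex X -> kan_fibration (to_pt X).
Proof.
move=> kX n r u v _; have [w wu] := kX n r u; exists w; split=> //.
by apply: smap_ext => k x /=; case: (v k x).
Qed.

Lemma from_empty_inj X n : injective (from_empty X n).
Proof. by case. Qed.

Lemma empty_eq X (f g : smap empty X) : f = g.
Proof. by apply: smap_ext => n []. Qed.

Lemma empty_prod_eq K X (f g : smap (sprod empty K) X) : f = g.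
Proof. by apply: smap_ext => n [[]]. Qed.

Definition sfst A B : smap (sprod A B) A :=
  @SMap (sprod A B) A (fun _ c => c.1) (fun _ _ _ _ => erefl).

(** The two ends of the cylinder on [K], as one object. *)
Definition ends K := sprod K (sset_of_type bool).

Definition end_of (e : bool) := if e then I1 else I0.

Definition ends_incl K : smap (ends K) (sprod K (simplex 1)).
refine (@SMap (ends K) (sprod K (simplex 1))
  (fun k c => (c.1, cst k (end_of c.2))) _).
Proof. by move=> m n a c; congr (_, _); rewrite /= mcomp_cst. Defined.

Lemma ends_incl_inj K n : injective (ends_incl K n).
Proof.
move=> [k e] [k' e'] h; have -> : k = k' := congr1 fst h.
have := mono_eqP ord0 (congr1 snd h : cst n (end_of e) = cst n (end_of e')).
by case: e e' {h} => [] [].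
Qed.

Definition ends_map K L X (f g : smap (sprod K L) X) :
  smap (sprod (ends K) L) X.
refine (@SMap (sprod (ends K) L) X
  (fun k c => if c.1.2 then g k (c.1.1, c.2) else f k (c.1.1, c.2)) _).
Proof. by move=> m n a [[x []] t] /=; rewrite -smap_nat. Defined.

(** The open box with bottom [b], left side [l] and right side [r] over a square
    in the base is filled, which yields its top. *)
Lemma square_lifting X Y (p : smap X Y) K (b l r : smap (sprod K (simplex 1)) X)
    (G : smap (sprod (sprod K (simplex 1)) (simplex 1)) Y) :
  kan_fibration p ->
  scomp p b = scomp G (at_end _ I0) ->
  scomp p l = scomp G (sprod_map (at_end K I0) (sid _)) ->
  scomp p r = scomp G (sprod_map (at_end K I1) (sid _)) ->
  scomp l (at_end K I0) = scomp b (at_end K I0) ->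
  scomp r (at_end K I0) = scomp b (at_end K I1) ->
  exists t : smap (sprod K (simplex 1)) X,
    [/\ scomp p t = scomp G (at_end _ I1),
        scomp t (at_end K I0) = scomp l (at_end K I1)
      & scomp t (at_end K I1) = scomp r (at_end K I1)].
Proof.
move=> kp pb pl pr lb rb.
have [||||H [pH _ HG]] := homotopy_lifting (i := ends_incl K) (f := b) (H := G)
  (G := ends_map l r) kp.
- exact: ends_incl_inj.
- exact: pb.
- apply: smap_ext => n [[k []] t] /=.
    exact: (smap_congr ((k, t) : sprod K (simplex 1) n) pr).
  exact: (smap_congr ((k, t) : sprod K (simplex 1) n) pl).
- apply: smap_ext => n [k []] /=.
    exact: (smap_congr k rb).
  exact: (smap_congr k lb).
exists (scomp H (at_end _ I1)); split.
- by rewrite -pH; apply: smap_ext.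
- apply: smap_ext => n k.
  exact: (smap_congr (((k, false), cst n I1) : sprod (ends K) (simplex 1) n) HG).
- apply: smap_ext => n k.
  exact: (smap_congr (((k, true), cst n I1) : sprod (ends K) (simplex 1) n) HG).
Qed.

Definition homotopic K X (f g : smap K X) := exists H : smap (sprod K (simplex 1)) X,
  scomp H (at_end K I0) = f /\ scomp H (at_end K I1) = g.

Lemma homotopic_post K X Y (p : smap X Y) (f g : smap K X) :
  homotopic f g -> homotopic (scomp p f) (scomp p g).
Proof. by case=> H [<- <-]; exists (scomp p H); split; apply: smap_ext. Qed.

Lemma homotopic_pre K L X (i : smap L K) (f g : smap K X) :
  homotopic f g -> homotopic (scomp f i) (scomp g i).
Proof.
case=> H [<- <-]; exists (scomp H (sprod_map i (sid _))).
by split; apply: smap_ext.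
Qed.

Lemma homotopic_refl K X (f : smap K X) : homotopic f f.
Proof. by exists (scomp f (sfst _ _)); split; apply: smap_ext. Qed.

Section KanHomotopy.
Variables (K X : sset) (kX : kan_complex X).

Lemma homotopic_box (b l r : smap (sprod K (simplex 1)) X) :
  scomp l (at_end K I0) = scomp b (at_end K I0) ->
  scomp r (at_end K I0) = scomp b (at_end K I1) ->
  homotopic (scomp l (at_end K I1)) (scomp r (at_end K I1)).
Proof.
move=> lb rb; have [|||t [_ t0 t1]] := @square_lifting _ _ (to_pt X) K b l r (to_pt _)
  (kan_to_pt kX) _ _ _ lb rb; try exact: smap_ext.
by exists t.
Qed.

Lemma homotopic_sym (f g : smap K X) : homotopic f g -> homotopic g f.
Proof.
case=> H [<- <-].
pose c := scomp (scomp H (at_end K I0)) (sfst K (simplex 1)).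
have -> : scomp H (at_end K I0) = scomp c (at_end K I1) by apply: smap_ext.
by apply: (@homotopic_box c); apply: smap_ext.
Qed.

Lemma homotopic_trans (f g h : smap K X) :
  homotopic f g -> homotopic g h -> homotopic f h.
Proof.
case=> H [<- Hg] [H' [H'g <-]].
pose c := scomp (scomp H (at_end K I0)) (sfst K (simplex 1)).
have -> : scomp H (at_end K I0) = scomp c (at_end K I1) by apply: smap_ext.
apply: (@homotopic_box H); first exact: smap_ext.
by rewrite H'g Hg.
Qed.

End KanHomotopy.

(** * Kan equivalences and trivial fibrations *)

Definition fun0 K X (f : smap K X) : sFun K X 0 := scomp f (sfst K (simplex 0)).

Definition at_pt K : smap K (sprod K (simplex 0)).
refine (@SMap K (sprod K (simplex 0)) (fun k b => (b, cst k ord0)) _).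
Proof. by move=> m n a x; congr (_, _); rewrite /= mcomp_cst. Defined.

Lemma simplex0_eq k (a b : mono k 0) : a = b.
Proof. by apply: mono_ext => i; rewrite (ord1 (a i)) (ord1 (b i)). Qed.

Lemma fun0K K X (x : sFun K X 0) : fun0 (scomp x (at_pt K)) = x.
Proof.
apply: smap_ext => n [k t] /=; congr (x n (_, _)); exact: simplex0_eq.
Qed.

Lemma fun0_at K X (f : smap K X) : scomp (fun0 f) (at_pt K) = f.
Proof. exact: smap_ext. Qed.

Lemma sFun_pre_fun0 K L X (i : smap K L) (f : smap L X) :
  sFun_pre X i 0 (fun0 f) = fun0 (scomp f i).
Proof. exact: smap_ext. Qed.

(** For a Kan complex [X] homotopy is an equivalence relation on maps to [X], so
    the zigzags of edges in the function complex reduce to single homotopies. *)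
Lemma connected_homotopic K X (x y : sFun K X 0) : kan_complex X ->
  connected x y -> homotopic (scomp x (at_pt K)) (scomp y (at_pt K)).
Proof.
move=> kX; elim=> {x y} [x y [e [<- <-]]|x|x y _|x y z _ h1 _ h2].
- by exists e; split; apply: smap_ext => n k /=;
    congr (e n (_, _)); apply: mono_ext.
- exact: homotopic_refl.
- exact: homotopic_sym.
- exact: homotopic_trans h1 h2.
Qed.

Lemma homotopic_connected K X (f g : smap K X) :
  homotopic f g -> connected (fun0 f) (fun0 g).
Proof.
case=> H [<- <-]; apply: rst_step; exists H.
by split; apply: smap_ext => n [k t] /=; congr (H n (_, _)); apply: mono_ext.
Qed.

Lemma smap_connected X Y (f : smap X Y) x y :
  connected x y -> connected (f 0 x) (f 0 y).
Proof.
elim=> {x y} [x y [e [<- <-]]|x|x y _|x y z _ h1 _ h2].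
- by apply: rst_step; exists (f 1 e); rewrite -!smap_nat.
- exact: rst_refl.
- exact: rst_sym.
- exact: rst_trans h1 h2.
Qed.

(** Two-out-of-three, inherited from bijections on [pi_0]. *)
Lemma kan_equivalence_cancel X Y Z (q : smap X Y) (p : smap Y Z) :
  kan_equivalence p -> kan_equivalence (scomp p q) -> kan_equivalence q.
Proof.
move=> ep epq T kT; have [ip sp] := ep T kT; have [ipq spq] := epq T kT.
have E x : sFun_pre T (scomp p q) 0 x = sFun_pre T q 0 (sFun_pre T p 0 x).
  exact: smap_ext.
split=> [y y' h|x].
  have [z hz] := sp y; have [z' hz'] := sp y'.
  apply: rst_trans (rst_sym _ _ _ _ hz) _; apply: rst_trans (hz').
  apply/smap_connected/ipq; rewrite !E.
  apply: rst_trans (smap_connected _ hz) _; apply: rst_trans h _.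
  exact: rst_sym (smap_connected _ hz').
by have [z] := spq x; rewrite E; exists (sFun_pre T p 0 z).
Qed.

(** A trivial fibration has a section, and the constant homotopy of [p] lifts
    to a homotopy from the induced retraction to the identity. *)
Lemma triv_fib_kan_equivalence X Y (p : smap X Y) :
  triv_fib p -> kan_equivalence p.
Proof.
move=> tp.
have lift A B (i : smap A B) (hi : forall n, injective (i n)) : rlp p i.
  exact: triv_fib_rlp.
have [|s [_ ps]] := lift _ _ _ (@from_empty_inj Y) (from_empty X) (sid Y).
  exact: empty_eq.
pose u : smap (ends X) X := scomp (ends_map (fun0 (scomp s p)) (fun0 (sid X)))
  (at_pt (ends X)).
have [|h [hu _]] := lift _ _ _ (@ends_incl_inj X) u (scomp p (sfst _ _)).
  apply: smap_ext => n [x []] //=.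
  exact: (smap_congr (p n x) ps).
have spid : homotopic (scomp s p) (sid X).
  exists h; split; apply: smap_ext => n x.
    exact: (smap_congr ((x, false) : ends X n) hu).
  exact: (smap_congr ((x, true) : ends X n) hu).
move=> Z kZ; split=> [f f' h0|g].
  have := smap_connected (sFun_pre Z s) h0.
  have E x : sFun_pre Z s 0 (sFun_pre Z p 0 x) = x.
    apply: smap_ext => n [y t] /=; congr (x n (_, _)); exact: (smap_congr y ps).
  by rewrite !E.
exists (fun0 (scomp (scomp g (at_pt X)) s)).
rewrite -{2}[g]fun0K sFun_pre_fun0; apply: homotopic_connected.
have := homotopic_post (scomp g (at_pt X)) spid.
by rewrite scompA scompf1.
Qed.

Definition imax k (s t : mono k 1) : mono k 1.
refine (@Mono k 1 (fun i => if s i == I0 then t i else I1) _).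
Proof.
move=> i j ij; have := mono_homo s ij; have := mono_homo t ij.
case: (I2P (s i)) => ->; case: (I2P (s j)) => -> //= _ _.
by case: (I2P (t i)) => ->.
Defined.

Lemma imax_comp l k (s t : mono k 1) (a : mono l k) :
  mcomp (imax s t) a = imax (mcomp s a) (mcomp t a).
Proof. exact: mono_ext. Qed.

Lemma imax0t k (t : mono k 1) : imax (cst k I0) t = t.
Proof. exact: mono_ext. Qed.

Lemma imaxt0 k (t : mono k 1) : imax t (cst k I0) = t.
Proof. by apply: mono_ext => i /=; case: (I2P (t i)) => ->. Qed.

Lemma imax1t k (t : mono k 1) : imax (cst k I1) t = cst k I1.
Proof. exact: mono_ext. Qed.

Lemma imaxt1 k (t : mono k 1) : imax t (cst k I1) = cst k I1.
Proof. by apply: mono_ext => i /=; case: ifP. Qed.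

(** The square whose sides at 0 are both [H] and whose sides at 1 are constant. *)
Definition max_homotopy X Y (H : smap (sprod X (simplex 1)) Y) :
  smap (sprod (sprod X (simplex 1)) (simplex 1)) Y.
refine (@SMap (sprod (sprod X (simplex 1)) (simplex 1)) Y
  (fun k c => H k (c.1.1, imax c.1.2 c.2)) _).
Proof. by move=> m n a c; rewrite -smap_nat /= imax_comp. Defined.

(** The test objects [X] and [Y] turn a Kan equivalence into a homotopy
    equivalence.  The homotopy [p r ~ id] lifts to make the inverse a section
    [s].  A homotopy [h] from [s p] to [id] need not be fibrewise; composing it
    with the reverse of [s p h] gives one whose projection to [Y] is
    [p h] run back and forth, and pushing this to a constant map, by
    [p h (x, max t u)], makes it fibrewise.  The fibrewise homotopy corrects
    [s v] to a lift of [v] that extends a given partial lift. *)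
Lemma kan_equivalence_triv_fib X Y (p : smap X Y) :
  kan_complex X -> kan_complex Y -> kan_fibration p -> kan_equivalence p ->
  triv_fib p.
Proof.
move=> kX kY kp ep.
have [r hr] : exists r, homotopic (scomp r p) (sid X).
  have [_ /(_ (fun0 (sid X)))[r]] := ep X kX.
  rewrite -[r]fun0K sFun_pre_fun0 => /(connected_homotopic kX).
  by rewrite !fun0_at => h; exists (scomp r (at_pt Y)).
have [H [H0 H1]] : homotopic (scomp p r) (sid Y).
  have [/(_ (fun0 (scomp p r)) (fun0 (sid Y)))] := ep Y kY.
  rewrite !sFun_pre_fun0 => /(_ _)/(connected_homotopic kY); rewrite !fun0_at.
  move=> h _; apply: h; apply: homotopic_connected.
  by have := homotopic_post p hr; rewrite scompA scompf1 scomp1f.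
have [||||H' [pH' H'0 _]] := homotopy_lifting (i := from_empty Y) (f := r)
  (H := H) (G := scomp (from_empty X) (sfst _ _)) kp.
- exact: from_empty_inj.
- by [].
- exact: empty_prod_eq.
- exact: empty_eq.
pose s := scomp H' (at_end Y I1).
have ps : scomp p s = sid Y by rewrite -H1 -pH'; apply: smap_ext.
have [h [h0 h1]] : homotopic (scomp s p) (sid X).
  apply: (homotopic_trans kX) hr; apply/(homotopic_sym kX)/homotopic_pre.
  by exists H'.
have pse n y : p n (s n y) = y := smap_congr y ps.
have h0e n x : h n (x, cst n I0) = s n (p n x) := smap_congr x h0.
have h1e n x : h n (x, cst n I1) = x := smap_congr x h1.
have [|||||t [pt t0 t1]] := @square_lifting _ _ p X h (scomp s (scomp p h))
    (sfst _ _) (max_homotopy (scomp p h)) kp.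
- by apply: smap_ext => n [x t] /=; rewrite imaxt0.
- by apply: smap_ext => n [x t] /=; rewrite pse imax0t.
- by apply: smap_ext => n [x t] /=; rewrite imax1t h1e.
- by apply: smap_ext => n x /=; rewrite h0e pse.
- by apply: smap_ext => n x /=; rewrite h1e.
have pte n x e : p n (t n (x, e)) = p n x.
  have := smap_congr ((x, e) : sprod X (simplex 1) n) pt.
  by rewrite /= imaxt1 h1e.
have t0e n x : t n (x, cst n I0) = s n (p n x).
  by have := smap_congr x t0; rewrite /= h1e.
have t1e n x : t n (x, cst n I1) = x := smap_congr x t1.
move=> n u v puv.
have puve m a : p m (u m a) = v m (boundary_incl n m a) := smap_congr a puv.
have [||||w [pw _ wu]] := homotopy_lifting (i := boundary_incl n)
  (f := scomp s v) (H := scomp v (sfst _ _)) (G := scomp t (sprod_map u (sid _))) kp.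
- exact: sval_inj_ssub.
- by apply: smap_ext => m a /=; rewrite pse.
- by apply: smap_ext => m [a e] /=; rewrite pte puve.
- by apply: smap_ext => m a /=; rewrite t0e puve.
exists (scomp w (at_end _ I1)); split; apply: smap_ext => m a /=.
  rewrite -(t1e m (u m a)).
  exact: (smap_congr ((a, cst m I1) : sprod (boundary n) (simplex 1) m) wu).
exact: (smap_congr ((a, cst m I1) : sprod (simplex n) (simplex 1) m) pw).
Qed.

(** * Partial maps and lifting problems *)
(** * Two-variable lifting for simplicial spaces *)

(** The maps from [A] into each space of [W].  The remaining simplicial direction
    is the categorical one, whereas [Map (discrete K) W] keeps the direction of
    the spaces. *)
Definition col (A : sset) (W : sspace) : sset.
refine (@SSet (fun k => smap A (W k)) (fun _ _ a f => scomp (sact W a) f) _ _).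
- by move=> n f; rewrite sact_id; apply: smap_ext.
- by move=> l m n b a f; rewrite sact_comp; apply: smap_ext.
Defined.

Definition col_pre (A D : sset) (j : smap A D) (W : sspace) :
  smap (col D W) (col A W).
refine (@SMap (col D W) (col A W) (fun _ f => scomp f j) _).
by move=> m n a f; apply: smap_ext.
Defined.

Section Curry.
Variables (A K : sset) (W : sspace).

Definition to_col_cell (u : smap A (Map (discrete K) W)) k (x : K k) :
  smap A (W k).
refine (@SMap A (W k) (fun l a => u l a k l (x, mid l)) _).
Proof.
move=> m n a y; rewrite (smap_nat u) -[RHS]smap_nat /=.
by rewrite mcomp1m mcompm1.
Defined.

Definition to_col (u : smap A (Map (discrete K) W)) : smap K (col A W).
refine (@SMap K (col A W) (to_col_cell u) _).
Proof.
move=> m n a x; apply: smap_ext => l y /=.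
exact: (@ssmap_natE _ _ (u l y) m n a l (x, mid l)).
Defined.

Definition of_col_level (h : smap K (col A W)) l (a : A l) k :
  smap (sprod (sset_of_type (K k)) (simplex l)) (W k).
refine (@SMap (sprod (sset_of_type (K k)) (simplex l)) (W k)
    (fun m c => h k c.1 m (act c.2 a)) _).
Proof. by move=> m n b c; rewrite -smap_nat -act_comp. Defined.

Definition of_col_cell (h : smap K (col A W)) l (a : A l) :
  Map (discrete K) W l.
refine (@SSMap (ssprod (discrete K) (constant (simplex l))) W
  (of_col_level h a) _).
Proof.
by move=> m n b; apply: smap_ext => k c /=; rewrite (smap_nat h).
Defined.

Definition of_col (h : smap K (col A W)) : smap A (Map (discrete K) W).
refine (@SMap A (Map (discrete K) W) (of_col_cell h) _).
Proof.
by move=> m n b x; apply: ssmap_ext => k l [y c] /=; rewrite act_comp.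
Defined.

Lemma to_colK u : of_col (to_col u) = u.
Proof.
apply: smap_ext => l a; apply: ssmap_ext => k m [x c] /=.
by rewrite smap_nat /= mcompm1.
Qed.

Lemma of_colK h : to_col (of_col h) = h.
Proof.
apply: smap_ext => k x; apply: smap_ext => l a /=.
by rewrite act_id.
Qed.

End Curry.

Lemma to_col_scomp A D K W (j : smap A D) (u : smap D (Map (discrete K) W)) :
  to_col (scomp u j) = scomp (col_pre j W) (to_col u).
Proof. by apply: smap_ext => k x; apply: smap_ext. Qed.

Lemma to_col_pre A K L W (i : smap K L) (u : smap A (Map (discrete L) W)) :
  to_col (scomp (Map_pre W (discrete_map i)) u) = scomp (to_col u) i.
Proof. by apply: smap_ext => k x; apply: smap_ext. Qed.

(** A lifting problem of [Map_pre W (discrete_map i)] against [j] and one of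
    [col_pre j W] against [i] are both a map on the union of [K x D] and [L x A]
    to be extended to [L x D]. *)
Lemma rlp_Map_col A D K L W (i : smap K L) (j : smap A D) :
  rlp (Map_pre W (discrete_map i)) j <-> rlp (col_pre j W) i.
Proof.
split=> H u v e.
- have [|w [wj iw]] := H (of_col v) (of_col u).
    rewrite -[LHS]to_colK to_col_pre of_colK -[RHS]to_colK to_col_scomp of_colK.
    by rewrite e.
  exists (to_col w); split.
    by rewrite -to_col_pre iw of_colK.
  by rewrite -to_col_scomp wj of_colK.
- have [|w [wi jw]] := H (to_col v) (to_col u).
    by rewrite -to_col_pre -to_col_scomp e.
  exists (of_col w); split.
    by rewrite -[LHS]to_colK to_col_scomp of_colK jw to_colK.
  by rewrite -[LHS]to_colK to_col_pre of_colK wi to_colK.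
Qed.

Section ReedyFibrant.
Variables (W : sspace) (hW : reedy_fibrant W).

Lemma reedy_col_triv_fib n (r : 'I_n.+2) : triv_fib (col_pre (horn_incl r) W).
Proof. by move=> m; apply/rlp_Map_col/hW. Qed.

Lemma reedy_Map_fibration K L (i : smap K L) :
  (forall n, injective (i n)) -> kan_fibration (Map_pre W (discrete_map i)).
Proof.
move=> inj_i n r; apply/rlp_Map_col/triv_fib_rlp => //; exact: reedy_col_triv_fib.
Qed.

(** [Map (discrete empty) W] is a point. *)
Lemma reedy_Map_kan K : kan_complex (Map (discrete K) W).
Proof.
move=> n r u; have L := @reedy_Map_fibration _ _ (from_empty K) (@from_empty_inj K).
have E m (f g : Map (discrete empty) W m) : f = g by apply: ssmap_ext => k l [[]].
pose v : smap (simplex n.+1) (Map (discrete empty) W) := of_col (from_empty _).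
have [|w [wu _]] := L n r u v; first by apply: smap_ext => m x; apply: E.
by exists w.
Qed.

(** [good C D]: restricting maps into [W] from [D] to [C] is a trivial
    fibration, expressed on the side where one attaches cells. *)
Definition good B (C D : spred B) :=
  forall n, lifts (col_pre (boundary_incl n) W) C D.

Lemma kan_equivalence_rlp K L (i : smap K L) : (forall n, injective (i n)) ->
  kan_equivalence (Map_pre W (discrete_map i)) ->
  forall n, rlp (col_pre (boundary_incl n) W) i.
Proof.
move=> inj_i ei n; apply/rlp_Map_col.
by apply: kan_equivalence_triv_fib => //; [exact: reedy_Map_kan|exact: reedy_Map_kan|
  exact: reedy_Map_fibration].
Qed.

Lemma rlp_kan_equivalence K L (i : smap K L) :
  (forall n, rlp (col_pre (boundary_incl n) W) i) ->
  kan_equivalence (Map_pre W (discrete_map i)).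
Proof.
by move=> H; apply: triv_fib_kan_equivalence => n; apply/rlp_Map_col.
Qed.

(** Right cancellation: between Kan complexes trivial fibrations are the Kan
    fibrations that are equivalences, and these satisfy two-out-of-three. *)
Lemma good_cancel B (C D : spred B) : act_closed C -> act_closed D ->
  (forall n b, C n b -> D n b) ->
  good C D -> good C (full B) -> good D (full B).
Proof.
move=> clC clD CD gCD gC.
pose i : smap (ssub clC) (ssub clD) := @SMap (ssub clC) (ssub clD)
  (fun n b => exist _ (sval b) (CD n _ (svalP b)))
  (fun m n a x => eq_exist _ _ erefl).
have inj_i n : injective (i n).
  by move=> [x hx] [y hy] e; apply: eq_exist; exact: (congr1 sval e).
have inj_s P (hP : @act_closed B P) := @sval_inj_ssub B P hP.
have eq_i n : rlp (col_pre (boundary_incl n) W) i.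
  apply: (lifts_rlp_sub (f := ssub_incl clD)) => //.
  apply: lifts_eq (gCD n) => k b; last by rewrite simg_ssub.
  split=> [h|[[x hx] /= <-] //]; by exists (exist _ b h).
have eC : kan_equivalence (Map_pre W (discrete_map (ssub_incl clC))).
  apply: rlp_kan_equivalence => n; apply: lifts_rlp => //.
  by apply: lifts_eq (gC n) => // k b; rewrite simg_ssub.
have eD : kan_equivalence (Map_pre W (discrete_map (ssub_incl clD))).
  apply: kan_equivalence_cancel (rlp_kan_equivalence eq_i) _.
  suff -> : scomp (Map_pre W (discrete_map i)) (Map_pre W (discrete_map (ssub_incl clD)))
    = Map_pre W (discrete_map (ssub_incl clC)) by [].
  by apply: smap_ext => n h; apply: ssmap_ext.
move=> n; apply: rlp_lifts_ssub.
by apply: kan_equivalence_rlp eD _.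
Qed.

End ReedyFibrant.

(** * Partial maps and lifting problems *)
(** * The doubled simplices *)

(** The doubled simplex consists of a reversed and a straight copy of [n]; both
    copies are folded onto [n]. *)
Definition fold n (i : 'I_(Qob n).+1) : 'I_n.+1 :=
  match @split n.+1 n.+1 i with inl j => rev_ord j | inr j => j end.

Lemma foldE n (i : 'I_(Qob n).+1) :
  fold i = (if i <= n then n - i else i - n.+1) :> nat.
Proof.
rewrite /fold; case: (@splitP n.+1 n.+1 i) => j e; rewrite e /=.
  by rewrite -ltnS ltn_ord subSS.
by rewrite leqNgt ltnS leq_addr /= addKn.
Qed.

Lemma Qmor_fold m n (a : mono m n) (x : 'I_(Qob m).+1) :
  fold (Qmor a x) = a (fold x).
Proof.
rewrite /fold /= /join_fun; case: (@splitP m.+1 m.+1 x) => j e.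
  by rewrite -[lshift _ _]/(unsplit (inl _)) unsplitK /= rev_ordK.
by rewrite -[rshift _ _]/(unsplit (inr _)) unsplitK.
Qed.

Lemma Qmor_side m n (a : mono m n) (x : 'I_(Qob m).+1) :
  (Qmor a x <= n) = (x <= m).
Proof.
rewrite /= /join_fun; case: (@splitP m.+1 m.+1 x) => j e; rewrite e.
  by rewrite /= subSS leq_subr; apply/esym; apply: (ltn_ord j).
by rewrite /=; lia.
Qed.

Lemma fold_inj n (i j : 'I_(Qob n).+1) :
  (i <= n) = (j <= n) -> fold i = fold j -> i = j.
Proof.
move=> s e; apply: val_inj; have := congr1 val e; rewrite /= !foldE s.
by case: ifP s => h1 h2; lia.
Qed.

Lemma QmorE m n (a : mono m n) (x : 'I_(Qob m).+1) :
  Qmor a x = (if x <= m then n - a (fold x) else n.+1 + a (fold x)) :> nat.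
Proof.
rewrite -Qmor_fold foldE Qmor_side; have := Qmor_side a x.
by case: ifP => h1 h2; rewrite h1; lia.
Qed.

Lemma Qmor_inj m n (a : mono m n) : injective a -> injective (Qmor a).
Proof.
move=> inj_a x y e; apply: fold_inj; first by rewrite -!(Qmor_side a) e.
by apply: inj_a; rewrite -!Qmor_fold e.
Qed.

Lemma fold_onto n (b : bool) (y : 'I_n.+1) :
  exists x : 'I_(Qob n).+1, (x <= n) = b /\ fold x = y.
Proof.
case: b.
  exists (lshift n.+1 (rev_ord y)); split; first by have := ltn_ord y; rewrite /=; lia.
  by rewrite /fold -[lshift _ _]/(unsplit (inl _)) unsplitK rev_ordK.
exists (rshift n.+1 y); split; first by rewrite /=; lia.
by rewrite /fold -[rshift _ _]/(unsplit (inr _)) unsplitK.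
Qed.

(** A vertex of the doubled simplex is determined by its image under [fold] and
    the copy to which it belongs, so it lies in the double of a face as soon as
    its image lies in the face. *)
Lemma Qmor_factor k l n (f : mono k (Qob n)) (g : mono l n) :
  (forall x, exists y, g y = fold (f x)) ->
  exists h : mono k (Qob l), f = mcomp (Qmor g) h.
Proof.
move=> fg; apply: mono_factor => x; have [y gy] := fg x.
have [z [zs zy]] := fold_onto (f x <= n) y.
by exists z; apply: fold_inj; rewrite ?Qmor_side // Qmor_fold zy.
Qed.

Definition sTw (X : sset) : sset.
refine (@SSet (fun n => X (Qob n)) (fun m n a => @act X _ _ (Qmor a)) _ _).
- by move=> n x; rewrite Qmor_id act_id.
- by move=> l m n b a x; rewrite Qmor_comp act_comp.
Defined.

Definition sTw_map X Y (q : smap X Y) : smap (sTw X) (sTw Y).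
refine (@SMap (sTw X) (sTw Y) (fun n => q (Qob n)) _).
Proof. by move=> m n a x; apply: (smap_nat q (Qmor a)). Defined.

(** The left Kan extension of [K] along the doubling functor, as a subcomplex of
    the doubled simplex: the union of the doubles of the simplices of [K]. *)
Definition doubled n (K : spred (simplex n)) : spred (simplex (Qob n)) :=
  fun k f => exists l (g : mono l n), K l g /\
    forall x, exists y, g y = fold (f x).

Section Extend.
Variables (n : nat) (K : spred (simplex n)) (clK : act_closed K) (X : sset).
Variable u : smap (ssub clK) (sTw X).
Arguments K : clear implicits.

(** The map from the doubled subcomplex to [X] adjoint to [u].  Injective faces
    suffice, and they make the factorization [h] unique. *)
Definition extend k (f : simplex (Qob n) k) (x : X k) :=
  exists l (g : mono l n) (Kg : K l g) (h : mono k (Qob l)),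
    [/\ injective g, f = mcomp (Qmor g) h & x = act h (u l (exist _ g Kg))].

Lemma doubled_face k (f : mono k (Qob n)) : doubled K f ->
  exists l (g : mono l n) (h : mono k (Qob l)),
    [/\ K l g, injective g & f = mcomp (Qmor g) h].
Proof.
case=> l [g [Kg gf]].
have [|l' [g' [inj_g' g'f]]] := @mono_image n (fun j => exists x, fold (f x) = j).
  by exists (fold (f ord0)), ord0.
have [h e] : exists h : mono k (Qob l'), f = mcomp (Qmor g') h.
  by apply: Qmor_factor => x; apply/g'f; exists x.
exists l', g', h; split=> //.
have [e' ->] : exists e' : mono l' l, g' = mcomp g e'.
  apply: mono_factor => i; have /g'f[x <-] : exists i', g' i' = g' i by exists i.
  exact: gf.
exact: (clK e' Kg).
Qed.

Lemma u_eq l (g g' : simplex n l) (Kg : K l g) (Kg' : K l g') : g = g' ->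
  u l (exist _ g Kg) = u l (exist _ g' Kg').
Proof. by move=> e; congr (u l _); apply: eq_exist. Qed.

Lemma u_act l m (g : simplex n l) (Kg : K l g) (e : mono m l)
    (Kge : K m (mcomp g e)) :
  u m (exist _ (mcomp g e) Kge) = act (Qmor e) (u l (exist _ g Kg)).
Proof.
rewrite -[RHS]/(act (s := sTw X) e (u l (exist _ g Kg))) -smap_nat.
by congr (u m _); apply: eq_exist.
Qed.

(** Two faces [g], [g'] of [K] whose doubles contain [f] meet in a face [g0]
    whose double contains [f]; both candidate values come from [u g0]. *)
Lemma extend_fun k (f : simplex (Qob n) k) x x' :
  extend f x -> extend f x' -> x = x'.
Proof.
case=> l [g [Kg [h [inj_g ef ->]]]] [l' [g' [Kg' [h' [inj_g' ef' ->]]]]].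
have [|l0 [g0 [inj_g0 g0f]]] := @mono_image n (fun j => exists x, fold (f x) = j).
  by exists (fold (f ord0)), ord0.
have [h0 e0] : exists h : mono k (Qob l0), f = mcomp (Qmor g0) h.
  by apply: Qmor_factor => y; apply/g0f; exists y.
have key m (a : mono m n) (Ka : K m a) (b : mono k (Qob m)) : injective a ->
    f = mcomp (Qmor a) b -> exists K0 : K l0 g0,
    act b (u m (exist _ a Ka)) = act h0 (u l0 (exist _ g0 K0)).
  move=> inj_a eb.
  have [e eg0] : exists e : mono l0 m, g0 = mcomp a e.
    apply: mono_factor => i; have /g0f[y <-] : exists i', g0 i' = g0 i by exists i.
    by exists (fold (b y)); rewrite eb /= Qmor_fold.
  have K0 : K l0 (mcomp a e) by apply: (clK e Ka).
  have K0' : K l0 g0 by rewrite eg0.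
  exists K0'; rewrite (u_eq K0' K0 eg0) (u_act Ka) -act_comp.
  congr (act _ _); apply: (mcomp_inj (Qmor_inj inj_a)).
  by rewrite mcompA -Qmor_comp -eg0 -eb -e0.
have [K0 ->] := key _ _ Kg _ inj_g ef; have [K0' ->] := key _ _ Kg' _ inj_g' ef'.
by rewrite (u_eq K0 K0').
Qed.

Lemma extend_act m k (a : mono m k) f x : extend f x -> extend (act a f) (act a x).
Proof.
case=> l [g [Kg [h [inj_g -> ->]]]]; exists l, g, Kg, (mcomp h a).
by split=> //; rewrite act_comp.
Qed.

Lemma extend_pmap : pmap (doubled K) extend.
Proof.
split; [exact: extend_act|exact: extend_fun|].
move=> k f; split=> [/doubled_face[l [g [h [Kg inj_g ef]]]]|].
  by exists (act h (u l (exist _ g Kg))), l, g, Kg, h.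
case=> x [l [g [Kg [h [inj_g ef _]]]]]; exists l, g; split=> // y.
by exists (fold (h y)); rewrite ef /= Qmor_fold.
Qed.

(** Any simplex [x] whose restrictions extend [u] on injective faces does so on
    all faces, since a face is a degeneration of an injective one. *)
Lemma extend_restrict (x : X (Qob n)) :
  (forall k f y, extend f y -> y = act f x :> X k) ->
  forall l (g : simplex n l) (Kg : K l g),
    u l (exist _ g Kg) = act (Qmor g) x.
Proof.
move=> hx l g Kg.
have [|l0 [g0 [h [K0 inj_g0 e]]]] := @doubled_face _ (Qmor g).
  exists l, g; split=> // y; exists (fold y); exact/esym/Qmor_fold.
have [e' eg] : exists e' : mono l l0, g = mcomp g0 e'.
  apply: mono_factor => i; have [z [_ <-]] := fold_onto true i.
  by exists (fold (h z)); rewrite -!Qmor_fold e.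
have Ke : K l (mcomp g0 e') by rewrite -eg.
rewrite (u_eq Kg Ke eg) (u_act K0) eg Qmor_comp act_comp; congr (act _ _).
apply: hx; exists l0, g0, K0, (mid _).
by rewrite act_id mcompm1.
Qed.

End Extend.

Lemma simplex_gen n k (f : simplex n k) : act f (mid n : simplex n n) = f.
Proof. exact: mcomp1m. Qed.

(** A lifting problem for [sTw_map q] against [K] is one for [q] against the
    doubled subcomplex. *)
Lemma sTw_rlp X Y (q : smap X Y) n (K : spred (simplex n)) (clK : act_closed K) :
  lifts q (doubled K) (full _) -> rlp (sTw_map q) (ssub_incl clK).
Proof.
move=> lq u v e; pose y : Y (Qob n) := v n (mid n).
have [||U [hU sU UV]] := lq _ _ _ (extend_pmap u) (pmap_graph (yoneda y)).
- by [].
- move=> k f x [l [g [Kg [h [_ -> ->]]]]] /=.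
  rewrite smap_nat act_comp; congr (act _ _).
  have := smap_congr (exist _ g Kg : ssub clK l) e; rewrite /= => ->.
  by rewrite -[act _ y]/(act (s := sTw Y) g y) -smap_nat simplex_gen.
have [|w hw] := pmap_smap hU; first by [].
pose x := w _ (mid (Qob n)).
have wx k f : w k f = act f x by rewrite -smap_nat simplex_gen.
exists (@yoneda (sTw X) n x); split.
- apply: smap_ext => l [g Kg]; apply/esym/extend_restrict => k f z /sU h.
  by rewrite -wx; apply: (pmap_fun hU) h (hw _ _).
- apply: smap_ext => l g; rewrite -[RHS](congr1 (v l) (simplex_gen g)).
  rewrite (smap_nat v) /= (smap_nat q); congr (act _ _).
  by have /= <- := UV _ _ _ (hw _ (mid (Qob n))); rewrite act_id.
Qed.

(** * Segal extensions of doubled subcomplexes *)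

Definition step n (j : 'I_n.+1) (j' : 'I_n.+1) (jj : j <= j') : mono 1 n.
refine (@Mono 1 n (fun x => if x == I0 then j else j') _).
Proof. by move=> x y; case: (I2P x) => ->; case: (I2P y) => ->. Defined.

Section SegalSpace.
Variables (W : sspace) (rW : reedy_fibrant W) (sW : segal W).

Lemma good_spine n : 0 < n -> good W (@spine_pred n) (full _).
Proof.
rewrite leq_eqVlt => /orP[/eqP <-|n2] m.
  apply: lifts_eq (@lifts_refl _ _ _ _ (full _)) => // k f; split=> // _.
  by rewrite /spine_pred; have := ltn_ord (f ord_max); lia.
have := @kan_equivalence_rlp W rW _ _ (ssub_incl (@spine_closed n)) _ (sW n2) m.
by move/(_ (@sval_inj_ssub _ _ _))/rlp_lifts_ssub.
Qed.

Lemma good_attach m n (s : mono m n) (C : spred (simplex n)) (S : spred (simplex m)) :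
  injective s -> (forall k (a : mono k m), C k (mcomp s a) <-> S k a) ->
  good W S (full _) -> good W C (predU C (simg (simplex_map s))).
Proof.
move=> inj_s CS gS k; apply: lifts_attach (gS k) => [//|l a a' e].
by right; apply: mcomp_inj e.
Qed.

Lemma good_trans B (C D E : spred B) : (forall n b, D n b -> E n b) ->
  good W C D -> good W D E -> good W C E.
Proof. by move=> DE h1 h2 n; apply: lifts_trans (h1 n) (h2 n). Qed.

Lemma good_eq B (C C' D D' : spred B) :
  (forall n b, C n b <-> C' n b) -> (forall n b, D n b <-> D' n b) ->
  good W C D -> good W C' D'.
Proof. by move=> h1 h2 h n; apply: lifts_eq (h n). Qed.

(** The spine of the doubled simplex with the doubles of the first [j] edges,
    where the edge from [i] to [i.+1] is the [i]-th. *)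
Definition segal_stage n j : spred (simplex (Qob n)) := fun k f =>
  spine_pred f \/ exists2 i, i < j & forall x, i <= fold (f x) <= i.+1.

Lemma segal_stage_closed n j : act_closed (@segal_stage n j).
Proof.
move=> l m a f [h|[i ij h]]; first by left; apply: spine_closed.
by right; exists i => // x; apply: (h (a x)).
Qed.

Lemma simg_simplex_map m n (s : mono m n) k (f : mono k n) :
  simg (simplex_map s) f <-> exists h, f = mcomp s h.
Proof. by split=> [[h <-]|[h ->]]; exists h. Qed.

(** The double of the edge from [j] to [j.+1] is the tetrahedron with vertices
    n-j-1, n-j, n+j+1, n+j+2.  It meets the stage [j] in its own spine: the two
    outer edges are in the big spine, and the middle one is the double of the
    vertex [j], which is in the double of the previous edge or, for [j = 0], in
    the big spine. *)
Lemma segal_stage_step n j : j < n ->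
  good W (@segal_stage n j) (@segal_stage n j.+1).
Proof.
(* The values on [p] of the tetrahedron [s] below, and their images under [fold]. *)
pose sv p := if p <= 1 then n - j.+1 + p else n + j.+1 + p - 2.
pose fv p := if (1 <= p) && (p <= 2) then j else j.+1.
move=> jn.
have aux1 p q : p <= q <= 3 -> sv q - sv p <= 1 -> q - p <= 1.
  by rewrite /sv; case: ifP => h1; case: ifP => h2; lia.
have aux2 i p q : p <= q <= 3 -> i < j -> i <= fv p <= i.+1 ->
    i <= fv q <= i.+1 -> q - p <= 1.
  by rewrite /fv; case: ifP => h1; case: ifP => h2; lia.
have aux3 p q : p <= q <= 3 -> q - p <= 1 ->
    ~~ [&& 0 < j, 0 < p & q <= 2] -> sv q - sv p <= 1.
  by rewrite /sv; case: ifP => h1; case: ifP => h2; lia.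
have aux4 p q r : 0 < j -> 0 < p -> q <= 2 -> p <= r <= q ->
    j.-1 <= fv r <= j.-1.+1.
  by rewrite /fv; case: ifP => h1; lia.
have aux5 x : x < 4 -> (if x <= 1 then n - fv x else n.+1 + fv x) = sv x.
  by rewrite /sv /fv; case: ifP => h1; case: ifP => h2; lia.
have jn0 : j < n.+1 by apply: ltnW.
have jj : Ordinal jn0 <= Ordinal (jn : j.+1 < n.+1) by apply: leqnSn.
pose s := Qmor (step jj).
have inj_s : injective s.
  apply: Qmor_inj => x y /(congr1 val) /=.
  by case: (I2P x) => ->; case: (I2P y) => -> //= /eqP; rewrite ?eqn_leq ltnn ?andbF.
have fs (x : 'I_(Qob 1).+1) : fold (s x) = fv x :> nat.
  rewrite Qmor_fold /= /fv.
  have [x0|[x1|[x2|x3]]] : val x = 0 \/ val x = 1 \/ val x = 2 \/ val x = 3.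
    by case: (x) => [[|[|[|[|]]]]] /=; auto.
  - have -> : fold x = I1 by apply: val_inj; rewrite /= foldE x0.
    by rewrite x0.
  - have -> : fold x = I0 by apply: val_inj; rewrite /= foldE x1.
    by rewrite x1.
  - have -> : fold x = I0 by apply: val_inj; rewrite /= foldE x2.
    by rewrite x2.
  - have -> : fold x = I1 by apply: val_inj; rewrite /= foldE x3.
    by rewrite x3.
have sE (x : 'I_(Qob 1).+1) : s x = sv x :> nat.
  by rewrite QmorE -Qmor_fold -/s fs; apply/aux5/ltn_ord.
have L : good W (@segal_stage n j) (predU (@segal_stage n j) (simg (simplex_map s))).
  apply: good_attach inj_s _ (@good_spine (Qob 1) isT) => k a.
  have amono x : a ord0 <= a x <= a ord_max.
    by rewrite !mono_homo // -ltnS.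
  have bm : a ord0 <= a ord_max <= 3.
    by have := amono ord0 => /andP[_ ->]; apply: (ltn_ord (a ord_max)).
  rewrite /segal_stage /spine_pred; split=> [[|[i ij h]]|h].
  - by rewrite !mcompE !sE; apply: aux1.
  - by apply: aux2 bm ij _ _; rewrite -fs; apply: h.
  - case: (boolP [&& 0 < j, 0 < a ord0 & a ord_max <= 2]) => [/and3P[h1 h2 h3]|hc].
      right; exists j.-1; first by rewrite prednK.
      by move=> x; rewrite mcompE fs; apply: aux4 (amono x).
    by left; rewrite !mcompE !sE; apply: aux3.
apply: good_eq L => // k f; rewrite /predU simg_simplex_map.
split=> [[[h|[i ij h]]|[h ->]]|[h|[i ij h]]].
- by left.
- by right; exists i => //; apply: ltnW.
- right; exists j => // x; rewrite mcompE fs /fv.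
  by case: ifP => _; rewrite ?leqnn leqnSn.
- by left; left.
- move: ij; rewrite ltnS leq_eqVlt => /orP[/eqP ij|ij]; last by left; right; exists i.
  right; apply: Qmor_factor => x; have := h x; rewrite ij.
  case: (ltnP j (fold (f x))) => h1 h2.
    by exists I1; apply: val_inj => /=; lia.
  by exists I0; apply: val_inj => /=; lia.
Qed.

(** For positive [n] the doubled edges already contain the big spine. *)
Lemma doubled_spine n k (f : mono k (Qob n)) : 0 < n ->
  doubled (@spine_pred n) f <-> segal_stage n f.
Proof.
move=> n0; split.
- case=> l [g [sg gf]]; right.
  case: (ltnP (g ord0) n) => gn.
    exists (g ord0) => // x; have [y <-] := gf x.
    have h1 : g ord0 <= g y by apply: mono_homo.
    have h2 : g y <= g ord_max by apply: mono_homo; rewrite -ltnS.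
    by move: sg; rewrite /spine_pred; lia.
  exists n.-1; first by rewrite prednK.
  move=> x; have [y <-] := gf x.
  have h1 : g ord0 <= g y by apply: mono_homo.
  by have := ltn_ord (g y); lia.
- move=> h; have [i hin hx] : exists2 i, i < n & forall x, i <= fold (f x) <= i.+1.
    case: h => // sf; rewrite /spine_pred in sf.
    (* The edge of [n] whose double contains the edge from [p] to [p.+1]; the
       minimum only matters for the last vertex [p], which has no successor. *)
    pose i0 p := if p <= n then n - p.+1 else minn (p - n.+1) n.-1.
    have aux1 p : p <= n + n.+1 -> i0 p < n by rewrite /i0; case: ifP => h1; lia.
    have aux2 p q r : p <= r <= q -> q <= n + n.+1 -> q - p <= 1 ->
        i0 p <= (if r <= n then n - r else r - n.+1) <= (i0 p).+1.
      by rewrite /i0; case: ifP => h1; case: ifP => h2; lia.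
    exists (i0 (f ord0)) => [|x]; first by apply: aux1; apply: (ltn_ord (f ord0)).
    rewrite foldE; apply: aux2 sf; last exact: (ltn_ord (f ord_max)).
    by rewrite !mono_homo // -ltnS.
  have hi : i < n.+1 by apply: ltnW.
  have jj : Ordinal hi <= Ordinal (hin : i.+1 < n.+1) by apply: leqnSn.
  exists 1, (step jj); split=> [|x]; first by rewrite /spine_pred /= subSnn.
  have := hx x; case: (ltnP i (fold (f x))) => h1 h2.
    by exists I1; apply: val_inj => /=; lia.
  by exists I0; apply: val_inj => /=; lia.
Qed.

(** Both the doubled spine and the whole doubled simplex are good extensions of
    the big spine. *)
Lemma good_doubled_spine n : 1 < n -> good W (doubled (@spine_pred n)) (full _).
Proof.
move=> n1; have n0 : 0 < n by apply: ltnW.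
have H j : j <= n -> good W (@spine_pred (Qob n)) (@segal_stage n j).
  elim: j => [_|j IH jn].
    apply: good_eq (fun m => @lifts_refl _ _ _ _ (@spine_pred (Qob n))) => // k f.
    by split=> [|[|[]//]]; first by left.
  apply: good_trans (IH (ltnW jn)) (segal_stage_step jn) => k f.
  by case=> [h|[i ij h]]; [left|right; exists i => //; apply: ltnW].
have : good W (@segal_stage n n) (full _).
  apply: good_cancel (H n (leqnn n)) _ => //.
  - exact: spine_closed.
  - exact: segal_stage_closed.
  - by move=> k f; left.
  - by apply: good_spine; rewrite /Qob addnS.
by apply: good_eq => // k f; rewrite doubled_spine.
Qed.

Definition incl_left n : mono n (Qob n).
refine (@Mono n (Qob n) (fun i => lshift n.+1 i) _).
Proof. by []. Defined.

Definition incl_right n : mono n (Qob n).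
refine (@Mono n (Qob n) (fun i => rshift n.+1 i) _).
Proof. by move=> i j ij; rewrite /= leq_add2l. Defined.

Lemma incl_left_inj n : injective (incl_left n).
Proof. by move=> i j /(congr1 val) /= /val_inj. Qed.

Lemma incl_right_inj n : injective (incl_right n).
Proof. by move=> i j /(congr1 val) /= /addnI/val_inj. Qed.

Lemma incl_left_factor n k (f : mono k (Qob n)) :
  (forall x, f x <= n) <-> exists h, f = mcomp (incl_left n) h.
Proof.
split=> [h|[h -> x]]; last by rewrite /= -ltnS ltn_ord.
by apply: mono_factor => x; exists (Ordinal (h x : f x < n.+1)); apply: val_inj.
Qed.

Lemma incl_right_factor n k (f : mono k (Qob n)) :
  (forall x, n < f x) <-> exists h, f = mcomp (incl_right n) h.
Proof.
split=> [h|[h -> x]]; last by rewrite /= ltnS leq_addr.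
apply: mono_factor => x; have lt : f x - n.+1 < n.+1.
  by have := ltn_ord (f x); have := h x; rewrite /Qob; lia.
by exists (Ordinal lt); apply: val_inj; rewrite /= subnKC.
Qed.

(** The two ends of the doubled simplex, the double of the vertex 0, and the
    doubles of the faces opposite to the vertices 1, ..., [j].  The last stage
    [j = n] is the double of the horn at 0 together with the two ends. *)
Definition ends_stage n j : spred (simplex (Qob n)) := fun k f =>
  [\/ forall x, f x <= n, forall x, n < f x, forall x, fold (f x) = 0 :> nat
    | exists2 i : 'I_n.+1, 0 < i <= j & forall x, fold (f x) <> i].

Lemma ends_stage_closed n j : act_closed (@ends_stage n j).
Proof.
move=> l m a f; case=> [h|h|h|[i ij h]].
- by constructor 1 => x; apply: (h (a x)).
- by constructor 2 => x; apply: (h (a x)).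
- by constructor 3 => x; apply: (h (a x)).
- by constructor 4; exists i => // x; apply: (h (a x)).
Qed.

(** The big spine is the union of the spines of the two ends and of the double of
    the vertex 0, so this stage arises by filling the two outer spines. *)
Lemma good_ends0 n : 0 < n -> good W (@ends_stage n 0) (full _).
Proof.
move=> n0; set sp := @spine_pred (Qob n).
have le_ends k m (f : mono k m) x : f ord0 <= f x <= f ord_max.
  by rewrite !mono_homo // -ltnS.
have h1 : good W sp (predU sp (simg (simplex_map (incl_left n)))).
  apply: good_attach (@incl_left_inj n) _ (good_spine n0) => k a.
  by [].
have h2 : good W (predU sp (simg (simplex_map (incl_left n))))
   (predU (predU sp (simg (simplex_map (incl_left n))))
      (simg (simplex_map (incl_right n)))).
  apply: good_attach (@incl_right_inj n) _ (good_spine n0) => k a.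
  rewrite /predU simg_simplex_map -incl_left_factor; split=> [[|h]|h].
  - by rewrite /sp /spine_pred /= subnDl.
  - by have := h ord0; rewrite /= leqNgt ltnS leq_addr.
  - by left; rewrite /sp /spine_pred /= subnDl.
have E k (f : mono k (Qob n)) : predU (predU sp (simg (simplex_map (incl_left n))))
      (simg (simplex_map (incl_right n))) f <-> ends_stage 0 f.
  rewrite /predU !simg_simplex_map -incl_left_factor -incl_right_factor.
  split=> [[[sf|h]|h]|[h|h|h|[i i0 _]]].
  - case: (leqP (f ord_max) n) => fm.
      by constructor 1 => x; have /andP[_ /leq_trans] := le_ends _ _ f x; apply.
    case: (ltnP n (f ord0)) => f0.
      by constructor 2 => x; have /andP[+ _] := le_ends _ _ f x; apply: leq_trans.
    constructor 3 => x; have := le_ends _ _ f x; move: sf.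
    by rewrite /sp /spine_pred foldE; case: ifP => h; lia.
  - by constructor 1.
  - by constructor 2.
  - by left; right.
  - by right.
  - left; left; have := h ord0; have := h ord_max; rewrite !foldE /sp /spine_pred.
    by case: ifP => h3; case: ifP => h4; lia.
  - by lia.
have clU : act_closed (predU (predU sp (simg (simplex_map (incl_left n))))
      (simg (simplex_map (incl_right n)))).
  by move=> l m a f; rewrite !E; apply: ends_stage_closed.
have : good W (predU (predU sp (simg (simplex_map (incl_left n))))
      (simg (simplex_map (incl_right n)))) (full _).
  apply: (@good_cancel W rW _ sp).
  - exact: spine_closed.
  - exact: clU.
  - by move=> k f h; left; left.
  - by apply: good_trans h1 h2 => k f h; left.
  - by apply: good_spine; rewrite /Qob addnS.
exact: good_eq.
Qed.

(** By induction on [n]: the stages [0] and [j] are both reached from the spine,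
    the latter because the double of the face opposite to [j.+1] meets the stage
    [j] in the stage [j] of its own doubled simplex. *)
Lemma good_ends n j : j <= n -> good W (@ends_stage n j) (full _).
Proof.
elim: n j => [|n IH] j jn.
  apply: good_eq (fun m => @lifts_refl _ _ _ _ (full _)) => // k f.
  by split=> // _; constructor 3 => x; rewrite (ord1 (fold (f x))).
have H i : i <= n.+1 -> good W (@ends_stage n.+1 0) (@ends_stage n.+1 i).
  elim: i => [_|i IHi iN].
    by move=> m; apply: lifts_refl.
  have mono_stage k f : @ends_stage n.+1 i k f -> @ends_stage n.+1 i.+1 k f.
    case=> [h|h|h|[i' ii' h]]; [by constructor 1|by constructor 2|by constructor 3|].
    by constructor 4; exists i' => //; lia.
  apply: good_trans (mono_stage) (IHi (ltnW iN)) _.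
  pose c : 'I_n.+2 := Ordinal (iN : i.+1 < n.+2).
  have L : good W (@ends_stage n.+1 i) (predU (@ends_stage n.+1 i)
      (simg (simplex_map (Qmor (mlift c))))).
    apply: good_attach (Qmor_inj (@mlift_inj n c)) _ (IH i iN) => k a.
    split=> [[h|h|h|[i' ii' h]]|[h|h|h|[i' ii' h]]].
    - by constructor 1 => x; rewrite -(Qmor_side (mlift c)); apply: h.
    - by constructor 2 => x; rewrite ltnNge -(Qmor_side (mlift c)) -ltnNge; apply: h.
    - constructor 3 => x; have := h x; rewrite Qmor_fold /= /bump.
      by move/eqP; rewrite addn_eq0 => /andP[_ /eqP].
    - have i'n : i' < n.+1 by lia.
      constructor 4; exists (Ordinal i'n) => // x e; apply: (h x).
      rewrite Qmor_fold e; apply: val_inj => /=; rewrite /bump leqNgt ltnS.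
      by have -> : i' <= i by lia.
    - by constructor 1 => x; rewrite Qmor_side; apply: h.
    - by constructor 2 => x; rewrite ltnNge Qmor_side -ltnNge; apply: h.
    - by constructor 3 => x; have := h x; rewrite mcompE Qmor_fold /= => ->.
    - constructor 4; exists (widen_ord (leqnSn _) i') => // x.
      rewrite Qmor_fold => /(congr1 val) /= e; apply: (h x); apply: val_inj.
      by move: e; rewrite /= /bump; case: leqP => h1 /=; lia.
  apply: good_eq L => // k f; rewrite /predU simg_simplex_map.
  split=> [[|[h ->]]|[h|h|h|[i' ii' h]]]; first exact: mono_stage.
  - constructor 4; exists c; first by rewrite /= leqnn.
    by move=> x; rewrite Qmor_fold; apply: mlift_neq.
  - by left; constructor 1.
  - by left; constructor 2.
  - by left; constructor 3.
  - case: (leqP i' i) => i'i; first by left; constructor 4; exists i' => //; lia.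
    right; apply: Qmor_factor => x; case: (unliftP c (fold (f x))) => [y e|e].
      by exists y; rewrite e.
    by case: (h x); rewrite e; apply: val_inj => /=; lia.
have clE i : act_closed (@ends_stage n.+1 i) by apply: ends_stage_closed.
apply: (good_cancel rW (clE 0) (clE j) _ (H j jn) (@good_ends0 n.+1 isT)).
move=> k f; case=> [h|h|h|[i' ii' h]]; [by constructor 1|by constructor 2|by constructor 3|].
by lia.
Qed.

End SegalSpace.

(** * The two ends of the twisted arrow construction *)

Lemma sval_inj T (P : T -> Prop) (s t : {x | P x}) : sval s = sval t -> s = t.
Proof. by case: s t => [x hx] [y hy] /= e; apply: eq_exist. Qed.

Lemma mopK m n (a : mono m n) : mop (mop a) = a.
Proof. by apply: mono_ext => i; rewrite /= !rev_ordK. Qed.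

Definition sop (X : sset) : sset.
refine (@SSet X (fun m n a => @act X _ _ (mop a)) _ _).
- by move=> n x; rewrite mop_id act_id.
- by move=> l m n b a x; rewrite mop_comp act_comp.
Defined.

Definition sop_map X Y (q : smap X Y) : smap (sop X) (sop Y).
refine (@SMap (sop X) (sop Y) q _).
Proof. by move=> m n a x; apply: (smap_nat q (mop a)). Defined.

Lemma Qmor_left m n (a : mono m n) :
  mcomp (Qmor a) (incl_left m) = mcomp (incl_left n) (mop a).
Proof.
by apply: mono_ext => i /=; rewrite /join_fun -[lshift _ i]/(unsplit (inl i)) unsplitK.
Qed.

Lemma Qmor_right m n (a : mono m n) :
  mcomp (Qmor a) (incl_right m) = mcomp (incl_right n) a.
Proof.
by apply: mono_ext => i /=; rewrite /join_fun -[rshift _ i]/(unsplit (inr i)) unsplitK.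
Qed.

Definition left_end X : smap (sTw X) (sop X).
refine (@SMap (sTw X) (sop X) (fun n x => act (s := X) (incl_left n) x) _).
Proof. by move=> m n a x; rewrite /= -!act_comp Qmor_left. Defined.

Definition right_end X : smap (sTw X) X.
refine (@SMap (sTw X) X (fun n x => act (s := X) (incl_right n) x) _).
Proof. by move=> m n a x; rewrite /= -!act_comp Qmor_right. Defined.

Section RelativeEnds.
Variables (X Y : sset) (q : smap X Y).

Definition over_ends_pred : spred (sprod (sprod (sTw Y) (sop X)) X) :=
  fun n c => q n c.1.2 = left_end Y n c.1.1 /\ q n c.2 = right_end Y n c.1.1.

Lemma over_ends_closed : act_closed over_ends_pred.
Proof.
move=> m n a [[y b] c] [/= hb hc]; split.
  by rewrite (smap_nat (left_end Y)) /= -hb; apply: (smap_nat q (mop a)).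
by rewrite (smap_nat (right_end Y)) /= -hc; apply: (smap_nat q a).
Qed.

(** The fibre product of [sTw Y] and [sop X x X] over [sop Y x Y]. *)
Definition over_ends := ssub over_ends_closed.

Lemma to_over_endsP n (x : sTw X n) :
  over_ends_pred ((sTw_map q n x, left_end X n x), right_end X n x).
Proof. by split; rewrite /= smap_nat. Qed.

Definition to_over_ends : smap (sTw X) over_ends.
refine (@SMap (sTw X) over_ends
  (fun n x => exist _ ((sTw_map q n x, left_end X n x), right_end X n x)
    (to_over_endsP x)) _).
Proof.
move=> m n a x; apply: eq_exist.
by rewrite (smap_nat (sTw_map q)) (smap_nat (left_end X)) (smap_nat (right_end X)).
Defined.

Lemma doubled_horn0 n k (f : mono k (Qob n.+1)) :
  [\/ doubled (@horn_pred n.+1 ord0) f, forall x, f x <= n.+1 | forall x, n.+1 < f x]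
  <-> ends_stage n.+1 f.
Proof.
split=> [[[l [g [[j j0 gj] gf]]]|h|h]|[h|h|h|[j j0 h]]].
- constructor 4; exists j.
    apply/andP; split; last by rewrite -ltnS; apply: (ltn_ord j).
    by rewrite lt0n; apply/eqP => e; apply/j0/val_inj.
  by move=> x; have [y <-] := gf x.
- by constructor 1.
- by constructor 2.
- by constructor 2.
- by constructor 3.
- constructor 1; exists 0, (cst 0 ord0); split; last first.
    by move=> x; exists ord0; apply: val_inj; rewrite /= h.
  by exists ord_max.
- constructor 1; exists n, (mlift j); split.
    exists j; last exact: mlift_neq.
    by move=> e; move: j0; rewrite e.
  move=> x; case: (unliftP j (fold (f x))) => [y e|e]; first by exists y; rewrite e.
  by case: (h x).
Qed.

(** The twisted arrow construction is a left fibration over its two ends: a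
    lifting problem against the horn at 0 amounts to one for [q] against the
    double of that horn together with the two ends of the doubled simplex. *)
Lemma ends_rlp n : lifts q (@ends_stage n.+1 n.+1) (full _) ->
  rlp to_over_ends (horn_incl (@ord0 n.+1)).
Proof.
move=> lq u v e.
case ev : (v n.+1 (mid n.+1)) => [[[y b] c] hyp]; have [/= qb qc] := hyp.
move: y b c hyp ev qb qc; rewrite /= => y b c hyp ev qb qc.
have vE l (g : simplex n.+1 l) :
    sval (v l g) = ((act (s := Y) (Qmor g) y, act (s := X) (mop g) b), act g c).
  by rewrite -[v l g](congr1 (v l) (simplex_gen g)) (smap_nat v) ev.
have uE l (g : simplex n.+1 l) Kg :
    [/\ q _ (u l (exist _ g Kg)) = act (s := Y) (Qmor g) y,
        act (s := X) (incl_left l) (u l (exist _ g Kg)) = act (s := X) (mop g) b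
      & act (s := X) (incl_right l) (u l (exist _ g Kg)) = act g c].
  have := congr1 sval (smap_congr (exist _ g Kg : horn ord0 l) e).
  rewrite /= vE => h; split.
  - exact: (congr1 (fun t => t.1.1) h).
  - exact: (congr1 (fun t => t.1.2) h).
  - exact: (congr1 (fun t => t.2) h).
pose U k (f : simplex (Qob n.+1) k) (x : X k) := [\/ extend u f x,
  exists2 h, f = mcomp (incl_left n.+1) h & x = act (s := X) h b
  | exists2 h, f = mcomp (incl_right n.+1) h & x = act h c].
(* On an end, [u] is prescribed by [b] or [c], since it lies over [v]. *)
have extl k f x h : extend u f x -> f = mcomp (incl_left n.+1) h ->
    x = act (s := X) h b :> X k.
  case=> l [g [Kg [h' [inj_g -> ->]]]] eh.
  have [h'' eh'] : exists h'', h' = mcomp (incl_left l) h''.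
    apply/incl_left_factor => i; rewrite -(Qmor_side g) -mcompE eh.
    by rewrite /= -ltnS ltn_ord.
  have [_ ul _] := uE l g Kg; rewrite eh' act_comp ul -act_comp.
  congr (act _ _); apply: (mcomp_inj (@incl_left_inj n.+1)).
  by rewrite mcompA -Qmor_left -eh eh' mcompA.
have extr k f x h : extend u f x -> f = mcomp (incl_right n.+1) h ->
    x = act h c :> X k.
  case=> l [g [Kg [h' [inj_g -> ->]]]] eh.
  have [h'' eh'] : exists h'', h' = mcomp (incl_right l) h''.
    apply/incl_right_factor => i; rewrite ltnNge -(Qmor_side g) -mcompE eh -ltnNge.
    by rewrite /= ltnS leq_addr.
  have [_ _ ur] := uE l g Kg; rewrite eh' act_comp ur -act_comp.
  congr (act _ _); apply: (mcomp_inj (@incl_right_inj n.+1)).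
  by rewrite mcompA -Qmor_right -eh eh' mcompA.
have lr k (h h' : mono k n.+1) :
    mcomp (incl_left n.+1) h <> mcomp (incl_right n.+1) h'.
  move=> eh; have := congr1 val (mono_eqP ord0 eh) => /= eh'.
  by have := ltn_ord (h ord0); rewrite eh' ltnNge leq_addr.
have hU : pmap (@ends_stage n.+1 n.+1) U.
  split.
  - move=> m k a f x [h|[h -> ->]|[h -> ->]].
    + by constructor 1; apply: extend_act.
    + by constructor 2; exists (mcomp h a); rewrite ?act_comp.
    + by constructor 3; exists (mcomp h a); rewrite ?act_comp.
  - move=> k f x x' [h|[h e1 e2]|[h e1 e2]] [h'|[h' e1' e2']|[h' e1' e2']].
    + exact: extend_fun h h'.
    + by rewrite e2'; apply: extl h e1'.
    + by rewrite e2'; apply: extr h e1'.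
    + by rewrite e2; apply/esym; apply: extl h' e1.
    + rewrite e2 e2'; congr (act _ _); apply: (mcomp_inj (@incl_left_inj n.+1)).
      by rewrite -e1.
    + by case: (lr _ h h'); rewrite -e1.
    + by rewrite e2; apply/esym; apply: extr h' e1.
    + by case: (lr _ h' h); rewrite -e1'.
    + rewrite e2 e2'; congr (act _ _); apply: (mcomp_inj (@incl_right_inj n.+1)).
      by rewrite -e1.
  - move=> k f; split=> [/doubled_horn0[h|h|h]|[x [h|[h e1 _]|[h e1 _]]]].
    + by have /(pmap_dom (extend_pmap u))[x hx] := h; exists x; constructor 1.
    + have /incl_left_factor[h' e1] := h.
      by exists (act (s := X) h' b); constructor 2; exists h'.
    + have /incl_right_factor[h' e1] := h.
      by exists (act h' c); constructor 3; exists h'.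
    + apply/doubled_horn0; constructor 1.
      by apply/(pmap_dom (extend_pmap u)); exists x.
    + by apply/doubled_horn0; constructor 2; apply/incl_left_factor; exists h.
    + by apply/doubled_horn0; constructor 3; apply/incl_right_factor; exists h.
have [||U' [hU' sU UV]] := lq _ _ _ hU (pmap_graph (yoneda y)).
- by [].
- move=> k f x [[l [g [Kg [h [_ -> ->]]]]]|[h -> ->]|[h -> ->]] /=.
  + by have [uq _ _] := uE l g Kg; rewrite act_comp (smap_nat q) uq.
  + by rewrite act_comp (smap_nat q) qb.
  + by rewrite act_comp (smap_nat q) qc.
have [|w hw] := pmap_smap hU'; first by [].
pose x := w _ (mid (Qob n.+1)).
have wx k f : w k f = act f x by rewrite -smap_nat simplex_gen.
have UE k f z : U k f z -> z = act f x.
  by move=> /sU h; rewrite -wx; apply: (pmap_fun hU') h (hw _ _).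
exists (@yoneda (sTw X) n.+1 x); split.
- apply: smap_ext => l [g Kg]; apply/esym/extend_restrict => k f z h.
  by apply: UE; constructor 1.
- apply: smap_ext => l g; apply: sval_inj; rewrite vE /=.
  have qx : y = q _ x by have /= <- := UV _ _ _ (hw _ (mid (Qob n.+1))); rewrite act_id.
  have bx : b = act (incl_left n.+1) x.
    by apply: UE; constructor 2; exists (mid _); rewrite ?act_id // mcompm1.
  have cx : c = act (incl_right n.+1) x.
    by apply: UE; constructor 3; exists (mid _); rewrite ?act_id // mcompm1.
  by rewrite qx bx cx (smap_nat q) -!act_comp Qmor_left Qmor_right.
Qed.

End RelativeEnds.

(** * The nerve of the free isomorphism *)

Definition NI : sset := nerve_sset I_cat.

Lemma NI_eq k (f g : NI k) : (forall i, f i = g i :> bool) -> f = g.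
Proof.
case: f g => [f m i c] [g m' i' c'] /= /funext e; case: g / e m' i' c' => m' i' c'.
by apply: functor_ext => x y h; case: (m _ _ _); case: (m' _ _ _).
Qed.

Definition NI_cell k (f : 'I_k.+1 -> bool) : NI k.
refine (@Functor (ordcat k) I_cat f (fun _ _ _ => tt) _ _).
- by [].
- by [].
Defined.

Definition word (x : bool) k : NI k := NI_cell (fun i : 'I_k.+1 => x (+) odd i).

Definition words x k : spred NI := simg (yoneda (word x k)).

Lemma wordsP x k l (f : NI l) :
  words x k f <-> exists a : mono l k, forall i, f i = x (+) odd (a i) :> bool.
Proof.
split=> [[a <-]|[a h]]; first by exists a.
by exists a; apply: NI_eq => i; rewrite h.
Qed.

Lemma wordsS x k l (f : NI l) : words x k f -> words x k.+1 f.
Proof.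
move/wordsP => [a h]; apply/wordsP.
have am (i j : 'I_l.+1) :
    i <= j -> widen_ord (leqnSn _) (a i) <= widen_ord (leqnSn _) (a j).
  exact: mono_homo.
by exists (@Mono l k.+1 (fun i => widen_ord (leqnSn k.+1) (a i)) am).
Qed.

Lemma words0 x l (f : NI l) : words x 0 f <-> f = const_functor (ordcat l) (x : I_cat).
Proof.
rewrite wordsP; split=> [[a h]|->].
  by apply: NI_eq => i; rewrite h (ord1 (a i)) /= addbF.
by exists (cst l ord0) => i; rewrite /= addbF.
Qed.

Lemma words_cover x l (f : NI l) : exists k, words x k f.
Proof.
(* The letter [i.*2] or its successor, according to the parity required. *)
exists l.*2.+1; apply/wordsP.
pose a (i : 'I_l.+1) := i.*2 + (f i != x :> bool).
have ha i : a i < l.*2.+2.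
  by have := ltn_ord i; rewrite /a; case: (_ != _) => /=; lia.
have am (i j : 'I_l.+1) : i <= j -> Ordinal (ha i) <= Ordinal (ha j).
  rewrite leq_eqVlt => /orP[/eqP/val_inj -> //|ij] /=; rewrite /a.
  by case: (_ != _); case: (_ != _) => /=; lia.
exists (Mono am) => i; rewrite /= /a oddD odd_double /=.
by case: (f i : bool); case: (x).
Qed.

(** A monotone word that hits every positive letter lies below each monotone
    word of the same parities, as both must change parity to move up. *)
Lemma word_le l m m' (a : mono l m) (a' : mono l m') :
  ~ horn_pred ord0 a -> (forall i, odd (a i) = odd (a' i)) ->
  forall i, a i <= a' i.
Proof.
move=> na par i; move: {2}(val (a i)) (leqnn (a i)) => c.
elim: c i => [|c IH] i aic; first by apply: leq_trans aic _.
move: aic; rewrite leq_eqVlt => /orP[/eqP ac|]; last by rewrite ltnS; apply: IH.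
case: c IH ac => [|c] IH ac.
  by rewrite ac; have := par i; rewrite ac; case: (val (a' i)).
have cm : c.+1 < m.+1 by have := ltn_ord (a i); rewrite ac; apply: ltn_trans.
have [i' ai'] : exists i', a i' = Ordinal cm.
  apply: contrapT => no; apply: na; exists (Ordinal cm).
    by move/(congr1 val).
  by move=> i' e; apply: no; exists i'.
have lt : i' <= i.
  by apply/ltnW/(mono_reflect_lt (g := a)); rewrite ai' ac.
have h1 : c.+1 <= a' i'.
  by have := IH i'; rewrite ai' /=; apply.
have h2 := leq_trans h1 (mono_homo a' lt).
rewrite ac; move: h2; rewrite leq_eqVlt => /orP[/eqP h2|//].
by have := par i; rewrite ac -h2 /=; case: (odd c).
Qed.

(** The word of dimension [k.+1] meets the shorter words in its horn at 0. *)
Lemma words_horn x k l (a : mono l k.+1) :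
  words x k (act a (word x k.+1)) <-> horn_pred ord0 a.
Proof.
rewrite wordsP; split=> [[a' h]|[j j0 aj]].
  apply: contrapT => na.
  have par i : odd (a i) = odd (a' i) by apply: (@addbI x); rewrite -h.
  have [i ai] : exists i, a i = ord_max.
    apply: contrapT => no; apply: na; exists ord_max; first by move/(congr1 val).
    by move=> i e; apply: no; exists i.
  by have := word_le na par i; rewrite ai leqNgt ltn_ord.
have jpos : 0 < j by rewrite lt0n; apply/eqP => e; apply/j0/val_inj.
have jk : j <= k.+1 by rewrite -ltnS.
(* Once the letter [j] is gone its neighbours are equal and get identified. *)
pose b (i : 'I_l.+1) := if a i < j then a i : nat else a i - 2.
have aj' i : a i != j :> nat by apply/eqP => /val_inj /aj.
have hb i : b i < k.+1.
  have := aj' i; have := ltn_ord (a i); rewrite /b.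
  by case: ifP => h; lia.
have bm (i i' : 'I_l.+1) : i <= i' -> Ordinal (hb i) <= Ordinal (hb i').
  move=> /(mono_homo a) /= h; have := aj' i; have := aj' i'; rewrite /b.
  by case: ifP => h1; case: ifP => h2; lia.
exists (Mono bm) => i /=; congr (_ (+) _); rewrite /b; case: ifP => // h.
by rewrite oddB /= ?addbF //; have := aj' i; lia.
Qed.

(** [NI] is built from a vertex by attaching, for each [k], the alternating word
    of dimension [k.+1] along its horn at 0: the face opposite to the last
    letter is the previous word, the inner faces are degenerate, and the face
    opposite to 0 starts with the other object. *)
Lemma NI_lifts X Y (p : smap X Y) x :
  (forall k, rlp p (horn_incl (@ord0 k.+1))) -> lifts p (words x 0) (full NI).
Proof.
move=> hp; apply: lifts_chain (words_cover x) => [k l f|k]; first exact: wordsS.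
have L : lifts p (words x k) (predU (words x k) (words x k.+1)).
  apply: lifts_attach (rlp_lifts_ssub (hp k)) => [l a|l a a' e].
    exact: words_horn.
  case: (pselect (horn_pred ord0 a)) => na; first by left.
  right; have na' : ~ horn_pred ord0 a'.
    by move/(words_horn x); rewrite -[act _ _]e => /words_horn.
  have par i : odd (a i) = odd (a' i).
    by apply: (@addbI x); exact: (congr1 (fun f : NI l => f i : bool) e).
  by apply: mono_eq => i; apply/eqP; rewrite eqn_leq !word_le.
by apply: lifts_eq L => // l f; split=> [[/wordsS|]|h] //; right.
Qed.

Definition NI_point (x : bool) (i : smap (simplex 0) NI) :=
  forall k t, i k t = const_functor (ordcat k) (x : I_cat).

Lemma NI_point_inj x i : NI_point x i -> forall n, injective (i n).
Proof. by move=> _ n s t _; apply: simplex0_eq. Qed.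

Definition rev_NI k (f : NI k) : NI k := NI_cell (fun i : 'I_k.+1 => f (rev_ord i)).

Lemma rev_NIK k (f : NI k) : rev_NI (rev_NI f) = f.
Proof. by apply: NI_eq => i /=; rewrite rev_ordK. Qed.

Lemma rev_NI_act m k (a : mono m k) (f : NI k) :
  rev_NI (act a f) = act (mop a) (rev_NI f).
Proof. by apply: NI_eq => i /=; rewrite rev_ordK. Qed.

Lemma rev_NI_const x k :
  rev_NI (const_functor (ordcat k) (x : I_cat)) = const_functor (ordcat k) (x : I_cat).
Proof. exact: NI_eq. Qed.

(** [NI] is isomorphic to its opposite, by a map that fixes its objects. *)
Lemma sop_rlp X Y (q : smap X Y) x i : NI_point x i ->
  rlp q i -> rlp (sop_map q) i.
Proof.
move=> ix lq u v e.
have nu m n (a : mono m n) t : u m (act a t) = act (s := X) a (u n t).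
  rewrite -{2}[a]mopK -[RHS](smap_nat u (mop a)).
  by congr (u m _); apply: simplex0_eq.
have nv m n (a : mono m n) f :
    v m (rev_NI (act a f)) = act (s := Y) a (v n (rev_NI f)).
  by rewrite rev_NI_act (smap_nat v) /= mopK.
have [|w [wi qw]] := lq (@SMap (simplex 0) X _ nu) (@SMap NI Y _ nv).
  apply: smap_ext => n t /=; rewrite ix rev_NI_const -(ix n t).
  exact: (smap_congr t e).
have nw m n (a : mono m n) f :
    w m (rev_NI (act a f)) = act (s := sop X) a (w n (rev_NI f)).
  by rewrite rev_NI_act (smap_nat w).
exists (@SMap NI (sop X) _ nw); split; apply: smap_ext => n t /=.
  by rewrite ix rev_NI_const -(ix n t); exact: (smap_congr t wi).
rewrite -{2}[t]rev_NIK; exact: (smap_congr (rev_NI t) qw).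
Qed.

(** Lift the two ends first, where completeness of [q] applies, and then the
    twisted arrows themselves, over these ends. *)
Lemma sTw_NI_rlp X Y (q : smap X Y) x i : NI_point x i -> rlp q i ->
  (forall k, rlp (to_over_ends q) (horn_incl (@ord0 k.+1))) ->
  rlp (sTw_map q) i.
Proof.
move=> ix lq hq u v e.
have [|b [bi qb]] := sop_rlp ix lq (u := scomp (left_end X) u)
    (v := scomp (left_end Y) v).
  apply: smap_ext => n t; rewrite /= (smap_nat q); congr (act _ _).
  exact: (smap_congr t e).
have [|c [ci qc]] := lq (scomp (right_end X) u) (scomp (right_end Y) v).
  apply: smap_ext => n t; rewrite /= (smap_nat q); congr (act _ _).
  exact: (smap_congr t e).
have hP n f : @over_ends_pred X Y q n ((v n f, b n f), c n f).
  by split; [exact: (smap_congr f qb)|exact: (smap_congr f qc)].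
have nP m n (a : mono m n) f : exist _ _ (hP m (act a f)) =
    act (s := over_ends q) a (exist _ _ (hP n f)).
  by apply: sval_inj; rewrite /= !smap_nat.
have ri : rlp (to_over_ends q) i.
  apply: lifts_rlp (NI_point_inj ix) _.
  apply: lifts_eq (@NI_lifts _ _ _ x hq) => // n f; rewrite words0.
  by split=> [->|[t <-]]; [exists (cst n ord0); rewrite ix|rewrite ix].
have [|w [wi rw]] := ri u (@SMap NI (over_ends q) _ nP).
  apply: smap_ext => n t; apply: sval_inj => /=.
  congr (_, _, _); [exact: (smap_congr t e)| |].
    exact: (smap_congr t (esym bi)).
  exact: (smap_congr t (esym ci)).
exists w; split=> //; apply: smap_ext => n f.
exact: (congr1 (fun z => (sval z).1.1) (smap_congr f rw)).
Qed.

(** * The twisted arrow construction *)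

(** [sTw (col D W)] and [col D (Tw W)] have the same cells and operators; only the
    proofs of functoriality differ. *)
Lemma col_Tw_rlp A D (j : smap A D) (W : sspace) K L (i : smap K L) :
  rlp (sTw_map (col_pre j W)) i -> rlp (col_pre j (Tw W)) i.
Proof.
move=> H u v e.
pose u' := @SMap K (sTw (col D W)) u (smap_nat u).
pose v' := @SMap L (sTw (col A W)) v (smap_nat v).
have [|w [wi jw]] := H u' v'.
  apply: smap_ext => n k; exact: (smap_congr k e).
exists (@SMap L (col D (Tw W)) w (smap_nat w)); split; apply: smap_ext => n k.
  exact: (smap_congr k wi).
exact: (smap_congr k jw).
Qed.

Lemma doubled_closed n (K : spred (simplex n)) : act_closed (doubled K).
Proof.
move=> m k a f [l [g [Kg gf]]]; exists l, g; split=> // x.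
exact: (gf (a x)).
Qed.

Theorem theorem4p10 (W : sspace) (hW : complete_segal_space W) :
  complete_segal_space (Tw W).
Proof.
case: hW => rW sW cW; split.
- move=> n m r; apply/rlp_Map_col/col_Tw_rlp/sTw_rlp/triv_fib_lifts.
    exact: reedy_col_triv_fib.
  exact: doubled_closed.
- move=> n n2; apply: rlp_kan_equivalence => m.
  exact/col_Tw_rlp/sTw_rlp/good_doubled_spine.
- move=> x.
  have [i [ei ix]] : exists i, nerve_point (x : I_cat) = discrete_map i /\ NI_point x i.
    by eexists; split.
  rewrite ei; apply: rlp_kan_equivalence => m.
  apply/col_Tw_rlp/(sTw_NI_rlp ix) => [|k].
    apply: kan_equivalence_rlp => //; first exact: NI_point_inj ix.
    by rewrite -ei; apply: cW.
  exact/ends_rlp/good_ends.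
Qed.
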